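(* Let $T>0$, let $\mu\ge 2$, and suppose that $u$, the solution of the periodic initial-value problem for the KdV equation $$u_t+uu_x+u_{xxx}=0,\quad x\in[-\pi,\pi],\ 0\le t\le T,\qquad u(x,0)=u_0(x),$$ belongs to $H^{\mu}$ for $t\in[0,T]$. For each integer $N\ge 1$ let $u^N$ be the Fourier-Galerkin semidiscrete approximation of $u$ in $S_N$ (defined in the context). Then there is a constant $C$, independent of $N$, such that $$\max_{0\le t\le T}\|u^N(t)-u(t)\|\le \frac{C}{N^{\mu-1}}.$$
   Context: All functions of $x$ are $2\pi$-periodic; $u_0$ is real-valued. $L^2=L^2(-\pi,\pi)$ has inner product $(v,w)=\int_{-\pi}^{\pi}v\overline{w}\,dx$ and norm $\|\cdot\|$. For real $\mu\ge 0$, $H^{\mu}$ is the $L^2$-based Sobolev space of periodic functions on $(-\pi,\pi)$ with norm $\|g\|_{\mu}=\left(\sum_{k\in\mathbb{Z}}(1+k^2)^{\mu}|\widehat g(k)|^2\right)^{1/2}$, where $\widehat g(k)=\frac1{2\pi}\int_{-\pi}^{\pi}e^{-ikx}g(x)\,dx$. ''The solution $u$ belongs to $H^\mu$ for $t\in[0,T]$'' means that $u_0\in H^\mu$ and $u\in C([0,T];H^{\mu})$ is the (unique, real-valued) solution of the initial-value problem, the equation being understood in $H^{\mu-3}$. For an integer $N\ge1$, $S_N=\mathrm{span}\{e^{ikx}: k\in\mathbb{Z},\ -N\le k\le N\}$, and $P_N$ is the $L^2$-projection onto $S_N$, $P_Nv=\sum_{|k|\le N}\widehat v(k)e^{ikx}$.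 The semidiscrete Fourier-Galerkin approximation is the real-valued map $u^N:[0,T]\to S_N$ satisfying $(u^N_t+u^Nu^N_x+u^N_{xxx},\chi)=0$ for all $\chi\in S_N$, $0\le t\le T$, and $u^N(0)=P_Nu_0$; it exists uniquely on $[0,T]$. *)

(* Defs.v *)
From mathcomp Require Import all_boot all_order all_algebra.
From mathcomp Require Import all_classical all_reals all_analysis.
From mathcomp Require Import complex.

Set Implicit Arguments.
Unset Strict Implicit.
Unset Printing Implicit Defensive.

Import Order.TTheory GRing.Theory Num.Theory.
Import numFieldNormedType.Exports.

Local Open Scope classical_set_scope.
Local Open Scope ring_scope.
Local Open Scope complex_scope.

Section PeriodicFunctions.
Context {R : realType}.
Implicit Types (f g : R -> R) (v w : R -> R[i]) (c d : int -> R[i]).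

Definition circle : set R := `[- pi, pi].

Definition toC f : R -> R[i] := fun x => (f x)%:C.

Definition cintegral v : R[i] :=
  (\int[lebesgue_measure]_(x in circle) complex.Re (v x))
  +i* (\int[lebesgue_measure]_(x in circle) complex.Im (v x)).

Definition inner v w : R[i] := cintegral (fun x => v x * (w x)^*).

Definition L2 f : Prop := f \_ circle \in Lfun lebesgue_measure 2%:E.

Definition L2norm f : \bar R :=
  Lnorm lebesgue_measure 2%:E (EFin \o (f \_ circle)).

(* x |-> e^{ikx} *)
Definition expi (k : int) : R -> R[i] :=
  fun x => cos (k%:~R * x) +i* sin (k%:~R * x).

Definition fourier v (k : int) : R[i] :=
  ((pi *+ 2)^-1)%:C * cintegral (fun x => expi (- k) x * v x).

(* For real s, an element of H^s (a distribution if s < 0) is represented by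
   its family c of Fourier coefficients; sobolev_norm s c is +oo when c does
   not define an element of H^s. *)
Definition sobolev_norm (s : R) c : \bar R :=
  ((\esum_(k in [set: int])
     ((1 + k%:~R ^+ 2) `^ s * ComplexField.Normc.normc (c k) ^+ 2)%:E)
   `^ (2^-1))%E.

(* d/dx on Fourier coefficients *)
Definition Dx c : int -> R[i] := fun k => (0 +i* k%:~R) * c k.

(* For s >= 0; functions are representatives of their classes modulo
   equality almost everywhere. *)
Definition sobolev (s : R) f : Prop :=
  [/\ periodic f (pi *+ 2), L2 f
    & (sobolev_norm s (fourier (toC f)) < +oo)%E].

(* Continuity on [0, T], with values in H^s. *)
Definition sobolev_continuous (s T : R) (c : R -> int -> R[i]) : Prop :=
  forall t, t \in `[0, T] ->
    sobolev_norm s (fun k => c tau k - c t k)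
      @[tau --> within `[0, T] (nbhs t)] --> 0%E.

(* d is the derivative at t, in the norm of H^s, of the curve c defined on
   [0, T] (one-sided at the endpoints). *)
Definition sobolev_derivative (s T : R) (c : R -> int -> R[i]) (t : R) d : Prop :=
  sobolev_norm s (fun k => ((tau - t)^-1)%:C * (c tau k - c t k) - d k)
    @[tau --> within `[0, T] t^'] --> 0%E.

Definition L2_derivative (T : R) (u : R -> R -> R) (t : R) f : Prop :=
  L2norm (fun x => (tau - t)^-1 * (u tau x - u t x) - f x)
    @[tau --> within `[0, T] t^'] --> 0%E.

(* u : [0, T] -> H^mu, written u t x; the values for t outside [0, T] are
   irrelevant.  In the last field, ux is the x-derivative of u t and ut its
   t-derivative, the latter an element of H^{mu-3}. *)
Record kdv_solution (T mu : R) (u0 : R -> R) (u : R -> R -> R) : Prop := {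
  kdv_data : sobolev mu u0;
  kdv_sobolev : forall t, t \in `[0, T] -> sobolev mu (u t);
  kdv_continuous : sobolev_continuous mu T (fun t => fourier (toC (u t)));
  kdv_initial : {ae lebesgue_measure, forall x, u 0 x = u0 x};
  kdv_equation : forall t, t \in `[0, T] ->
    exists (ux : R -> R) (ut : int -> R[i]),
    [/\ periodic ux (pi *+ 2) /\ L2 ux,
        fourier (toC ux) = Dx (fourier (toC (u t))),
        (sobolev_norm (mu - 3) ut < +oo)%E,
        sobolev_derivative (mu - 3) T (fun tau => fourier (toC (u tau))) t ut
      & forall k, ut k + fourier (toC (fun x => u t x * ux x)) k
                  + iter 3 Dx (fourier (toC (u t))) k = 0] }.

(* The integers k with |k| <= N. *)
Definition freqs (N : nat) : seq int :=
  [seq j%:Z - N%:Z | j <- iota 0 N.*2.+1].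

Definition trig_sum (N : nat) c : R -> R[i] :=
  fun x => \sum_(k <- freqs N) c k * expi k x.

(* The space S_N. *)
Definition trig_poly (N : nat) : set (R -> R[i]) := range (trig_sum N).

(* The L^2-projection P_N onto S_N. *)
Definition fourier_proj (N : nat) v : R -> R[i] := trig_sum N (fourier v).

Record galerkin (T : R) (u0 : R -> R) (N : nat) (uN : R -> R -> R) : Prop := {
  galerkin_space : forall t, t \in `[0, T] -> trig_poly N (toC (uN t));
  galerkin_initial : toC (uN 0) = fourier_proj N (toC u0);
  galerkin_equation : forall t, t \in `[0, T] ->
    exists uNt : R -> R,
    [/\ trig_poly N (toC uNt), L2_derivative T uN t uNt
      & forall chi, trig_poly N chi ->
        inner (toC (fun x =>
                 uNt x + uN t x * (uN t)^`()%classic x + (uN t)^`(3)%classic x))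
              chi = 0] }.

End PeriodicFunctions.

Arguments circle : clear implicits.

(* M is the maximum of F over [0, T]. *)
Definition is_max {R : realType} (T : R) (F : R -> \bar R) (M : \bar R) : Prop :=
  (exists2 t, t \in `[0, T] & F t = M) /\
  (forall t, t \in `[0, T] -> (F t <= M)%E).

(* Main.v *)
Require Import Defs.
From mathcomp Require Import all_boot all_order all_algebra.
From mathcomp Require Import all_classical all_reals all_analysis.
From mathcomp Require Import complex.
From mathcomp Require Import ring lra zify.
From mathcomp Require Import measurable_realfun.

Import Order.TTheory GRing.Theory Num.Theory.
Import numFieldNormedType.Exports.

(** The error [uN - u] is the sum of [e = uN - P u] in [S_N] and of minus the
    truncation error [r = u - P u], with [P = P_N].  Everything is done on Fourier
    coefficients: write [a t] for those of [u t] and [b t] for those of [uN t].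
    Both families solve ordinary differential equations
    ([kdv_ode], [galerkin_ode]), so [e = b - a] on [|k| <= N] satisfies
    [e_t + e_xxx + P (uN (uN)_x - u u_x) = 0] with [e = 0] at time [0].
    Testing against [e] kills the dispersive term ([Re_conj_Dx3]), and with
    [w = P u] the nonlinear term is expanded by [uN = e + w] and [u = w + r].
    The integral of [e e e_x] vanishes, the two terms linear in [w] combine to half
    of that of [w_x e e] ([flux_identity]), and the rest is linear in [r] or [r_x].
    Young's inequality ([trilinear_young]) bounds these terms by [|e| ^ 2 + eta]
    times a sum of moduli of coefficients of [u] or [w_x]; such sums are bounded because
    [u] is bounded in [H^mu] with [mu >= 2] ([sobolev_bound_l1]), and
    [eta = B / N ^ (2 (mu - 1))] bounds the squared norms of [r] and [r_x]
    ([high_pass_tail]).  Hence [E = |e| ^ 2] satisfies [E' <= K (E + eta)]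
    ([energy_rate]) with [K] independent of [N], and Gronwall's inequality gives
    [E + eta <= eta exp (K T)].

    Three facts connect coefficients with functions.  A function with vanishing
    Fourier coefficients vanishes almost everywhere ([annihilated_ae0]):
    powers of a suitable polynomial in [cos (x - m)] approximate the indicator of
    an arc boundedly, and Lebesgue's differentiation theorem concludes.  So a
    function with absolutely summable coefficients is the sum of its Fourier series
    ([fourier_series_ae]); this makes the coefficients of [u u_x] limits of
    convolutions ([fourier_mul_cvg]) and bounds the mean-square norm by the
    coefficients ([parseval_le]).  Finally the [H^mu]-norm of [u t] is bounded
    uniformly in [t] by compactness of [[0, T]] ([sobolev_continuous_bounded]), and
    the maximum of the error is attained because the error is continuous in time
    with values in [L^2] ([error_max]). *)

Set Implicit Arguments.
Unset Strict Implicit.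
Unset Printing Implicit Defensive.

Local Open Scope classical_set_scope.
Local Open Scope ring_scope.
Local Open Scope complex_scope.

Local Notation nc := ComplexField.Normc.normc.

(** * Symmetric frequency windows *)

Lemma mem_freqs N (k : int) : (k \in freqs N) = (`|k| <= N%:Z).
Proof.
apply/mapP/idP => [[j]|kN].
  by rewrite mem_iota => jN ->; lia.
by exists (absz (k + N%:Z)%R); [rewrite mem_iota; lia|lia].
Qed.

Lemma freqs_uniq N : uniq (freqs N).
Proof. by rewrite map_inj_uniq ?iota_uniq// => i j ij; lia. Qed.

#[local] Opaque freqs.

Section WindowSums.
Context {V : nmodType}.
Implicit Types F : int -> V.

Lemma sum_freqsN N F : \sum_(k <- freqs N) F (- k) = \sum_(k <- freqs N) F k.
Proof.
rewrite -(big_map -%R xpredT F); apply: perm_big; apply: uniq_perm.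
- by rewrite (map_inj_uniq oppr_inj) freqs_uniq.
- exact: freqs_uniq.
move=> k; rewrite -[k in LHS]opprK (mem_map oppr_inj) !mem_freqs.
by rewrite normrN.
Qed.

Lemma sum_freqsS N F : \sum_(k <- freqs N.+1) F k =
  F N.+1%:Z + (F (- N.+1%:Z) + \sum_(k <- freqs N) F k).
Proof.
rewrite -!(big_cons _ _ _ _ xpredT); apply: perm_big; apply: uniq_perm.
- exact: freqs_uniq.
- by rewrite 2!cons_uniq in_cons freqs_uniq !mem_freqs; lia.
- by move=> k; rewrite [LHS]mem_freqs 2!in_cons mem_freqs; lia.
Qed.

Lemma sum_freqs0 F : \sum_(k <- freqs 0) F k = F 0.
Proof.
rewrite -[RHS](big_seq1 +%R 0 F).
apply: perm_big; apply: uniq_perm => [||k]; [exact: freqs_uniq|by []|].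
by rewrite [LHS]mem_freqs mem_seq1; lia.
Qed.

Lemma sum_freqs_widen N M F : (N <= M)%N ->
  (forall k, N%:Z < `|k| -> F k = 0) ->
  \sum_(k <- freqs M) F k = \sum_(k <- freqs N) F k.
Proof.
move=> NM F0; rewrite (bigID (fun k => k \in freqs N))/= [X in _ + X]big1 ?addr0.
  rewrite -big_filter; apply: perm_big; apply: uniq_perm => [||k].
  - exact/filter_uniq/freqs_uniq.
  - exact: freqs_uniq.
  - by rewrite mem_filter !mem_freqs; lia.
by move=> k; rewrite mem_freqs -ltNge => /F0.
Qed.

Lemma sum_freqs_delta N F k : k \in freqs N ->
  (forall j, j != k -> F j = 0) -> \sum_(j <- freqs N) F j = F k.
Proof.
move=> kN F0; rewrite (bigD1_seq k) ?freqs_uniq// big1 /= ?addr0// => j _; exact: F0.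
Qed.

End WindowSums.

Section WindowBounds.
Context {R : realType}.
Implicit Types F : int -> R.

Lemma sum_freqs_le N M F : (N <= M)%N -> (forall k, 0 <= F k) ->
  \sum_(k <- freqs N) F k <= \sum_(k <- freqs M) F k.
Proof.
move=> NM F0; elim: M NM => [|M IH]; first by rewrite leqn0 => /eqP->.
rewrite leq_eqVlt => /predU1P[->//|/IH/le_trans->//].
by rewrite sum_freqsS addrA lerDr addr_ge0.
Qed.

Lemma term_le_freqs F k (N := absz k) : (forall k, 0 <= F k) ->
  F k <= \sum_(k <- freqs N) F k.
Proof.
move=> F0; rewrite (bigD1_seq k) ?freqs_uniq//; last by rewrite mem_freqs/N; lia.
by rewrite lerDl sumr_ge0.
Qed.

(** The bound telescopes because
    [2 / (1 + (M+1)^2) <= 4 / (M+1) - 4 / (M+2)]. *)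
Lemma sum_inv_sq_le M : \sum_(k <- freqs M) (1 + k%:~R ^+ 2)^-1 <= 5 :> R.
Proof.
suff: \sum_(k <- freqs M) (1 + k%:~R ^+ 2)^-1 <= 5 - 4 / M.+1%:R :> R.
  by move=> /le_trans; apply; rewrite gerBl divr_ge0.
elim: M => [|M IH]; first by rewrite sum_freqs0 expr0n/= addr0 invr1; lra.
rewrite sum_freqsS -(natr1 M.+1) rmorphN/= sqrrN addrA.
apply: (le_trans (lerD (lexx _) IH)); rewrite -pmulrn.
set m : R := M.+1%:R.
have m1 : 1 <= m by rewrite ler1n.
have m0 : m != 0 by lra.
have m2 : m + 1 != 0 by lra.
have m3 : 1 + m ^+ 2 != 0 by nra.
rewrite -subr_ge0.
have -> : 5 - 4 / (m + 1) - ((1 + m ^+ 2)^-1 + (1 + m ^+ 2)^-1 + (5 - 4 / m)) =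
  (4 * (1 + m ^+ 2) - 2 * m * (m + 1)) * (m * (m + 1) * (1 + m ^+ 2))^-1.
  by field; apply/and3P.
by apply: mulr_ge0; [nra|rewrite invr_ge0; nra].
Qed.

End WindowBounds.

(** * The trilinear form of the Burgers nonlinearity *)

Section Trilinear.
Context {C : comNzRingType}.
Implicit Types x y z : int -> C.

(** For trigonometric polynomials [X], [Y], [Z] with coefficients [x], [y], [z] on
    the window this is the mean of [X Y Z] over the circle. *)
Definition trilinear (L : nat) x y z : C :=
  \sum_(k <- freqs L) \sum_(j <- freqs L) \sum_(l <- freqs L)
    (k + j + l == 0)%:R * (x k * y j * z l).

Lemma trilinear_swap12 L x y z : trilinear L x y z = trilinear L y x z.
Proof.
rewrite /trilinear exchange_big; apply: eq_bigr => k _; apply: eq_bigr => j _.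
by apply: eq_bigr => l _; rewrite [j + k]addrC [x j * _]mulrC.
Qed.

Lemma trilinear_swap23 L x y z : trilinear L x y z = trilinear L x z y.
Proof.
rewrite /trilinear; apply: eq_bigr => k _; rewrite exchange_big.
by apply: eq_bigr => j _; apply: eq_bigr => l _; rewrite addrAC mulrAC.
Qed.

Lemma trilinearDr L x y z z' :
  trilinear L x y (fun k => z k + z' k) = trilinear L x y z + trilinear L x y z'.
Proof.
rewrite /trilinear -big_split; apply: eq_bigr => k _; rewrite -big_split.
apply: eq_bigr => j _; rewrite -big_split; apply: eq_bigr => l _ /=.
by rewrite -mulrDr -mulrDr.
Qed.

Lemma trilinearDm L x y y' z :
  trilinear L x (fun k => y k + y' k) z = trilinear L x y z + trilinear L x y' z.
Proof. by rewrite !(trilinear_swap23 _ x _ z) trilinearDr. Qed.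

(** Integration by parts: on [k + j + l = 0] the additive symbol [d] of a
    derivation sums to zero. *)
Lemma trilinear_parts L (d : int -> C) x y z :
  (forall k j l, k + j + l = 0 -> d k + d j + d l = 0) ->
  trilinear L (fun k => d k * x k) y z + trilinear L x (fun k => d k * y k) z
  + trilinear L x y (fun k => d k * z k) = 0.
Proof.
move=> d0; rewrite /trilinear -!big_split big1// => k _; rewrite -!big_split.
rewrite big1// => j _; rewrite -!big_split big1// => l _ /=.
have [/d0 D|] := eqVneq; last by rewrite !mul0r !addr0.
rewrite !mul1r -[RHS](mul0r (x k * y j * z l)) -D; ring.
Qed.

End Trilinear.

Section ComplexNorm.
Context {R : realType}.
Implicit Types z w : R[i].

Lemma ReD z w : complex.Re (z + w) = complex.Re z + complex.Re w.
Proof. by case: z w => x y [x' y']. Qed.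

Lemma ReB z w : complex.Re (z - w) = complex.Re z - complex.Re w.
Proof. by case: z w => x y [x' y']. Qed.

Lemma ImB z w : complex.Im (z - w) = complex.Im z - complex.Im w.
Proof. by case: z w => x y [x' y']. Qed.

Lemma Re_realM (r : R) z : complex.Re (r%:C * z) = r * complex.Re z.
Proof. by case: z => x y /=; rewrite mul0r subr0. Qed.

Lemma Im_realM (r : R) z : complex.Im (r%:C * z) = r * complex.Im z.
Proof. by case: z => x y /=; rewrite mul0r addr0. Qed.

Lemma conj_eq_real z : conjc z = z -> (complex.Re z)%:C = z.
Proof.
case: z => a b [] /eqP; rewrite eq_sym -subr_eq0 opprK -mulr2n mulrn_eq0/=.
by move=> /eqP ->.
Qed.

Lemma nc_ge0 z : 0 <= nc z.
Proof. by case: z => a b; exact: sqrtr_ge0. Qed.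

Lemma nc_sqr z : nc z ^+ 2 = complex.Re z ^+ 2 + complex.Im z ^+ 2.
Proof. by case: z => a b /=; rewrite sqr_sqrtr// addr_ge0 ?sqr_ge0. Qed.

Lemma nc_sum (I : Type) (s : seq I) (F : I -> R[i]) :
  nc (\sum_(i <- s) F i) <= \sum_(i <- s) nc (F i).
Proof.
elim/big_rec2: _ => [|i y z _ IH]; first by rewrite ComplexField.Normc.normc0.
by apply: le_trans (le_normcD _ _) _; rewrite lerD2l.
Qed.

Lemma nc_real (x : R) : nc x%:C = `|x|.
Proof. by rewrite /= expr0n /= addr0 sqrtr_sqr. Qed.

Lemma nc_Re z : `|complex.Re z| <= nc z.
Proof.
rewrite -[leLHS]sqrtr_sqr -[leRHS]ger0_norm ?nc_ge0// -sqrtr_sqr.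
by rewrite ler_wsqrtr// nc_sqr lerDl sqr_ge0.
Qed.

Lemma nc_Im z : `|complex.Im z| <= nc z.
Proof.
rewrite -[leLHS]sqrtr_sqr -[leRHS]ger0_norm ?nc_ge0// -sqrtr_sqr.
by rewrite ler_wsqrtr// nc_sqr lerDr sqr_ge0.
Qed.

Lemma nc_le_ReIm z : nc z <= `|complex.Re z| + `|complex.Im z|.
Proof.
rewrite -(@ler_pXn2r _ 2%N)// ?nnegrE ?nc_ge0 ?addr_ge0//.
rewrite nc_sqr -(normr_id (complex.Re z)) -(real_normK (num_real (complex.Re z))).
rewrite -(real_normK (num_real (complex.Im z))) normr_id.
have := normr_ge0 (complex.Re z); have := normr_ge0 (complex.Im z); nra.
Qed.

Lemma nc_conj z : nc (conjc z) = nc z.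
Proof. by case: z => a b /=; rewrite sqrrN. Qed.

Lemma nc_sub z z' : nc (z - z') = nc (z' - z).
Proof. by rewrite -normcN opprB. Qed.

Lemma nc_dist z w : `|nc z - nc w| <= nc (z - w).
Proof.
rewrite ler_norml; apply/andP; split.
  rewrite lerNl opprB lerBlDr nc_sub -{1}(subrK z w); exact: le_normcD.
by rewrite lerBlDr -{1}(subrK w z); exact: le_normcD.
Qed.

End ComplexNorm.

Section TrilinearBound.
Context {R : realType}.
Implicit Types x y z : int -> R[i].

Lemma sum_delta_le1 L (k : int) : \sum_(j <- freqs L) (k + j == 0)%:R <= 1 :> R.
Proof.
have [kL|kL] := boolP (- k \in freqs L).
  rewrite (sum_freqs_delta kL) ?subrr// => j jk.
  by rewrite addrC addr_eq0 (negbTE jk).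
rewrite big1_seq// => j /= jL; case: eqP => // kj.
by move: kL; rewrite (_ : - k = j) ?jL//; lia.
Qed.

(** Young's inequality for convolutions, with Cauchy-Schwarz weakened to the
    arithmetic-geometric mean so that no square root appears. *)
Lemma trilinear_young L x y z (X Y Z : R) :
  \sum_(k <- freqs L) nc (x k) ^+ 2 <= X ->
  \sum_(k <- freqs L) nc (y k) ^+ 2 <= Y ->
  \sum_(k <- freqs L) nc (z k) <= Z ->
  nc (trilinear L x y z) <= (X + Y) / 2 * Z.
Proof.
move=> Xx Yy Zz.
have half x' : \sum_(l <- freqs L) \sum_(k <- freqs L) \sum_(j <- freqs L)
    (k + j + l == 0)%:R * (nc (x' k) ^+ 2 * nc (z l)) <=
    (\sum_(k <- freqs L) nc (x' k) ^+ 2) * (\sum_(l <- freqs L) nc (z l)).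
  rewrite mulr_sumr; apply: ler_sum => l _; rewrite mulr_suml.
  apply: ler_sum => k _; rewrite -mulr_suml.
  apply: ler_piMl; first by rewrite mulr_ge0 ?sqr_ge0 ?nc_ge0.
  under eq_bigr do rewrite addrAC.
  exact: sum_delta_le1.
have Z0 : 0 <= \sum_(l <- freqs L) nc (z l) by apply: sumr_ge0 => *; exact: nc_ge0.
have Xs0 : 0 <= \sum_(l <- freqs L) nc (x l)^+2 by apply: sumr_ge0 => *; exact: sqr_ge0.
have Ys0 : 0 <= \sum_(l <- freqs L) nc (y l)^+2 by apply: sumr_ge0 => *; exact: sqr_ge0.
apply: (@le_trans _ _ (((\sum_(k <- freqs L) nc (x k) ^+ 2)
   * (\sum_(l <- freqs L) nc (z l)) + (\sum_(k <- freqs L) nc (y k) ^+ 2) *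
   (\sum_(l <- freqs L) nc (z l))) / 2)); last first.
  rewrite -mulrDl mulrAC ler_pM ?divr_ge0 ?addr_ge0//.
  by rewrite ler_pM2r// lerD.
apply: (@le_trans _ _ (\sum_(k <- freqs L) \sum_(j <- freqs L) \sum_(l <- freqs L)
    ((k + j + l == 0)%:R * ((nc (x k) ^+ 2 + nc (y j) ^+ 2) / 2 * nc (z l))))).
  apply: le_trans (nc_sum _ _) _; apply: ler_sum => k _.
  apply: le_trans (nc_sum _ _) _; apply: ler_sum => j _.
  apply: le_trans (nc_sum _ _) _; apply: ler_sum => l _.
  case: (k + j + l == 0); last by rewrite !mul0r ComplexField.Normc.normc0.
  rewrite !mul1r !ComplexField.Normc.normcM ler_wpM2r ?nc_ge0//.
  have := sqr_ge0 (nc (x k) - nc (y j)); lra.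
have -> : \sum_(k <- freqs L) \sum_(j <- freqs L) \sum_(l <- freqs L)
    ((k + j + l == 0)%:R * ((nc (x k) ^+ 2 + nc (y j) ^+ 2) / 2 * nc (z l))) =
  (\sum_(l <- freqs L) \sum_(k <- freqs L) \sum_(j <- freqs L)
    (k + j + l == 0)%:R * (nc (x k) ^+ 2 * nc (z l)) +
  \sum_(l <- freqs L) \sum_(k <- freqs L) \sum_(j <- freqs L)
    (k + j + l == 0)%:R * (nc (y k) ^+ 2 * nc (z l))) / 2.
  rewrite -big_split mulr_suml.
  under eq_bigr do rewrite exchange_big.
  rewrite exchange_big; apply: eq_bigr => l _ /=.
  rewrite [X in _ + X]exchange_big -big_split mulr_suml; apply: eq_bigr => k _.
  rewrite -big_split mulr_suml; apply: eq_bigr => j _ /=.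
  rewrite (addrC j k); ring.
by rewrite ler_pM2r// lerD.
Qed.

Lemma Dx_symbol (k j l : int) : k + j + l = 0 ->
  (0 +i* k%:~R) + (0 +i* j%:~R) + (0 +i* l%:~R) = 0 :> R[i].
Proof.
move=> kjl; apply/eqP; rewrite eq_complex /= !addr0 eqxx/=.
by rewrite -!rmorphD/= kjl.
Qed.

(** The terms with three or two factors [e] integrate by parts: [(e e_x, e) = 0]
    and [((e w)_x, e) = (w_x e, e) / 2]; what remains is linear in
    the truncation errors [r1] and [r].  They are two sequences because the two
    factors of [u u_x] are cut at different frequencies. *)
Lemma flux_identity L (e w r1 r : int -> R[i]) :
  trilinear L e (fun k => e k + w k) (Dx (fun k => e k + w k))
  - trilinear L e (fun k => w k + r1 k) (Dx (fun k => w k + r k)) =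
  trilinear L e e (Dx w) / 2 - trilinear L e r1 (Dx w)
  - trilinear L e (fun k => w k + r1 k) (Dx r).
Proof.
have DxD (x y : int -> R[i]) : Dx (fun k => x k + y k) = fun k => Dx x k + Dx y k.
  by apply/funext => k; rewrite /Dx mulrDr.
rewrite !DxD !trilinearDr !trilinearDm.
have Peee := trilinear_parts L e e e Dx_symbol.
have Pewe := trilinear_parts L e w e Dx_symbol.
rewrite -!/(Dx _) in Peee Pewe.
have eee : trilinear L e e (Dx e) = 0.
  move: Peee; rewrite (trilinear_swap12 _ (Dx e)).
  rewrite (trilinear_swap23 _ e (Dx e)) => /eqP.
  by rewrite -mulr2n -mulrSr mulrn_eq0 /= => /eqP.
have ewe : trilinear L e w (Dx e) = - (trilinear L e e (Dx w) / 2).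
  move: Pewe; rewrite (trilinear_swap12 _ (Dx e)) (trilinear_swap23 _ w (Dx e)).
  rewrite (trilinear_swap12 _ w e) (trilinear_swap23 _ e (Dx w)) => P.
  apply: (@mulIf _ (2%:R : R[i])); first by rewrite pnatr_eq0.
  rewrite mulNr divfK ?pnatr_eq0// mulr_natr; apply/eqP; rewrite -addr_eq0 mulr2n.
  by rewrite -P; apply/eqP; ring.
by rewrite eee ewe; field.
Qed.

Lemma flux_bound L (e w r1 r : int -> R[i]) (A0 A1 eta : R)
  (E := \sum_(k <- freqs L) nc (e k) ^+ 2) :
  \sum_(k <- freqs L) nc (w k + r1 k) <= A0 ->
  \sum_(k <- freqs L) nc (Dx w k) <= A1 ->
  \sum_(k <- freqs L) nc (r1 k) ^+ 2 <= eta ->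
  \sum_(k <- freqs L) nc (Dx r k) ^+ 2 <= eta ->
  nc (trilinear L e (fun k => e k + w k) (Dx (fun k => e k + w k))
  - trilinear L e (fun k => w k + r1 k) (Dx (fun k => w k + r k)))
  <= (A0 / 2 + A1) * (E + eta).
Proof.
move=> hA0 hA1 h1 h2; rewrite flux_identity.
have eta0 : 0 <= eta by apply: le_trans h1; apply: sumr_ge0 => *; exact: sqr_ge0.
have A00 : 0 <= A0 by apply: le_trans hA0; apply: sumr_ge0 => *; exact: nc_ge0.
have A10 : 0 <= A1 by apply: le_trans hA1; apply: sumr_ge0 => *; exact: nc_ge0.
have T1 : nc (trilinear L e e (Dx w) / 2) <= E * A1 / 2.
  rewrite ComplexField.Normc.normcM ComplexField.Normc.normcV.
  rewrite (_ : nc 2 = 2); last first.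
    by rewrite -(rmorph_nat (real_complex R) 2) nc_real normr_nat.
  rewrite ler_pM2r//; apply: le_trans (trilinear_young (lexx _) (lexx _) hA1) _.
  rewrite -/E; lra.
have T2 := trilinear_young (lexx E) h1 hA1.
have T3 := trilinear_young (lexx E) h2 hA0.
rewrite trilinear_swap23 in T3.
apply: le_trans (le_normcD _ _) _; rewrite normcN.
apply: le_trans (lerD (le_normcD _ _) (lexx _)) _; rewrite normcN.
apply: le_trans (lerD (lerD T1 T2) T3) _.
have : 0 <= A1 * eta by exact: mulr_ge0.
rewrite -subr_ge0 => h.
rewrite -subr_ge0 (_ : _ - _ = A1 * eta / 2); first by rewrite divr_ge0// -[_ * _]subr0.
by field.
Qed.

End TrilinearBound.

(** * Integration over the circle *)

Section CircleIntegral.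
Context {R : realType}.
Notation mu := (@lebesgue_measure R).
Implicit Types (f g : R -> R) (v w : R -> R[i]).

Definition circle_integrable f : Prop := mu.-integrable (circle R) (EFin \o f).

Definition cintegrable v : Prop :=
  circle_integrable (fun x => complex.Re (v x)) /\
  circle_integrable (fun x => complex.Im (v x)).

Lemma measurable_circle : measurable (circle R : set (measurableTypeR R)).
Proof. exact: measurable_itv. Qed.

Lemma continuous_circle_integrable f : continuous f -> circle_integrable f.
Proof.
move=> cf; apply: continuous_compact_integrable; first exact: segment_compact.
by apply: continuous_subspaceT => x; exact: cf.
Qed.

Lemma eq_circle_integrable f g : f =1 g -> circle_integrable f ->
  circle_integrable g.
Proof. by move=> /funext ->. Qed.

Lemma circle_integrable_norm f : circle_integrable f ->
  circle_integrable (fun x => `|f x|).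
Proof. exact: integrable_norm. Qed.

Lemma circle_integrableD f g : circle_integrable f -> circle_integrable g ->
  circle_integrable (fun x => f x + g x).
Proof. by move=> If Ig; exact: (integrableD measurable_circle If Ig). Qed.

Lemma circle_integrableZ (r : R) f : circle_integrable f ->
  circle_integrable (fun x => r * f x).
Proof. by move=> If; exact: (integrableZl measurable_circle r If). Qed.

Lemma circle_integrableN f : circle_integrable f ->
  circle_integrable (fun x => - f x).
Proof.
by move=> /(circle_integrableZ (-1)); under eq_fun do rewrite mulN1r.
Qed.

Lemma circle_integrableB f g : circle_integrable f -> circle_integrable g ->
  circle_integrable (fun x => f x - g x).
Proof. by move=> If /circle_integrableN; exact: circle_integrableD. Qed.

Lemma circle_integrable_measurable f : circle_integrable f ->
  measurable_fun (circle R : set (measurableTypeR R)) f.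
Proof. by case/integrableP => /measurable_EFinP. Qed.

Lemma circle_integrableM f g (K : R) : circle_integrable f ->
  measurable_fun (circle R : set (measurableTypeR R)) g -> (forall x, circle R x -> `|g x| <= K) ->
  circle_integrable (fun x => f x * g x).
Proof.
move=> If mg gK; have mf := circle_integrable_measurable If.
apply: (le_integrable measurable_circle _ _ (circle_integrableZ K If)).
  by apply/measurable_EFinP; exact: measurable_funM.
move=> x cx /=; rewrite lee_fin normrM mulrC [X in _ <= X]normrM.
by rewrite ler_wpM2r// (le_trans (gK x cx))// ler_norm.
Qed.

Lemma circle_integrable_bounded f (K : R) : measurable_fun (circle R : set (measurableTypeR R)) f ->
  (forall x, circle R x -> `|f x| <= K) -> circle_integrable f.
Proof.
move=> mf fK.
have: circle_integrable (fun=> 1) by apply: continuous_circle_integrable => x; exact: cvg_cst.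
move=> /circle_integrableM/(_ mf fK); by under eq_fun do rewrite mul1r.
Qed.

Lemma circle_integral_cst (K : R) : \int[mu]_(x in circle R) K = K * (pi *+ 2).
Proof.
rewrite Rintegral_cst; last exact: measurable_circle.
suff E : mu (circle R) = (pi *+ 2)%:E by congr (K * _); exact: (congr1 fine E).
rewrite /circle; have /= -> := lebesgue_measure_itv `[- pi : R, pi].
rewrite lte_fin ifT; first by rewrite opprK mulr2n.
by rewrite (lt_trans _ (pi_gt0 R))// oppr_lt0 pi_gt0.
Qed.

Lemma circle_integral_le f (K : R) : circle_integrable f ->
  (forall x, circle R x -> `|f x| <= K) ->
  `|\int[mu]_(x in circle R) f x| <= K * (pi *+ 2).
Proof.
move=> If fK; apply: le_trans (le_normr_Rintegral measurable_circle If) _.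
rewrite -circle_integral_cst.
apply: le_Rintegral => //.
- exact: measurable_circle.
- exact: circle_integrable_norm.
- by apply: continuous_circle_integrable => x; exact: cvg_cst.
Qed.

Lemma cintegrableD v w : cintegrable v -> cintegrable w ->
  cintegrable (fun x => v x + w x).
Proof.
move=> [v1 v2] [w1 w2]; split.
- under eq_fun do rewrite raddfD; exact: circle_integrableD.
- under eq_fun do rewrite raddfD; exact: circle_integrableD.
Qed.

Lemma cintegralD v w : cintegrable v -> cintegrable w ->
  cintegral (fun x => v x + w x) = cintegral v + cintegral w.
Proof.
move=> [v1 v2] [w1 w2]; apply/eqP; rewrite eq_complex /=; apply/andP; split.
- rewrite -RintegralD//; last exact: measurable_circle.
  by apply/eqP; apply: eq_Rintegral => x _; rewrite raddfD.
- rewrite -RintegralD//; last exact: measurable_circle.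
  by apply/eqP; apply: eq_Rintegral => x _; rewrite raddfD.
Qed.

Lemma cintegrableZ (c : R[i]) v : cintegrable v -> cintegrable (fun x => c * v x).
Proof.
case: c => a b [v1 v2]; split.
- apply: (eq_circle_integrable _ (circle_integrableB (circle_integrableZ a v1) (circle_integrableZ b v2))) => x /=.
  by case: (v x).
- apply: (eq_circle_integrable _ (circle_integrableD (circle_integrableZ a v2) (circle_integrableZ b v1))) => x /=.
  by case: (v x).
Qed.

Lemma cintegralZ (c : R[i]) v : cintegrable v ->
  cintegral (fun x => c * v x) = c * cintegral v.
Proof.
case: c => a b [v1 v2]; have mc := measurable_circle.
rewrite /cintegral; apply/eqP; rewrite eq_complex /=; apply/andP; split.
- rewrite -!RintegralZl// -RintegralB//; [|exact: circle_integrableZ..].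
  by apply/eqP; apply: eq_Rintegral => x _; case: (v x).
- rewrite -!RintegralZl// -RintegralD//; [|exact: circle_integrableZ..].
  by apply/eqP; apply: eq_Rintegral => x _; case: (v x).
Qed.

Lemma eq_cintegral v w : v =1 w -> cintegral v = cintegral w.
Proof. by move=> vw; congr cintegral; apply/funext. Qed.

Lemma cintegrable0 : cintegrable (fun=> 0).
Proof. by split; apply: continuous_circle_integrable => x; exact: cvg_cst. Qed.

Lemma cintegral0 : cintegral (fun=> 0) = 0 :> R[i].
Proof.
rewrite -[RHS](mul0r (cintegral (fun=> 0))) -(cintegralZ 0 cintegrable0).
by apply: eq_cintegral => x; rewrite mul0r.
Qed.

Lemma cintegrable_sum (I : Type) (s : seq I) (F : I -> R -> R[i]) :
  (forall i, cintegrable (F i)) -> cintegrable (fun x => \sum_(i <- s) F i x).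
Proof.
move=> IF; elim: s => [|i s IH].
  by under eq_fun do rewrite big_nil; exact: cintegrable0.
by under eq_fun do rewrite big_cons; exact: cintegrableD.
Qed.

Lemma cintegral_sum (I : Type) (s : seq I) (F : I -> R -> R[i]) :
  (forall i, cintegrable (F i)) ->
  cintegral (fun x => \sum_(i <- s) F i x) = \sum_(i <- s) cintegral (F i).
Proof.
move=> IF; elim: s => [|i s IH].
  by under eq_cintegral do rewrite big_nil; rewrite big_nil cintegral0.
under eq_cintegral do rewrite big_cons.
rewrite big_cons cintegralD// ?IH//; exact: cintegrable_sum.
Qed.

Lemma cintegral_conj v : cintegrable v ->
  cintegral (fun x => conjc (v x)) = conjc (cintegral v).
Proof.
move=> [v1 v2]; apply/eqP; rewrite eq_complex /=; apply/andP; split; apply/eqP.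
- by apply: eq_Rintegral => x _; case: (v x).
- rewrite -mulN1r -RintegralZl//; last exact: measurable_circle.
  by apply: eq_Rintegral => x _; case: (v x) => a b /=; rewrite mulN1r.
Qed.

Lemma cintegrable_toC f : circle_integrable f -> cintegrable (toC f).
Proof.
by move=> If; split => //=; apply: continuous_circle_integrable => x; exact: cvg_cst.
Qed.

End CircleIntegral.

(** * Exponentials and Fourier coefficients *)

Section Fourier.
Context {R : realType}.
Notation mu := (@lebesgue_measure R).
Implicit Types (f g : R -> R) (v w : R -> R[i]) (k j : int).

Lemma expiD k j (x : R) : expi (k + j) x = expi k x * expi j x.
Proof.
rewrite /expi rmorphD/= mulrDl cosD sinD; apply/eqP; rewrite eq_complex /=.
by rewrite eqxx/= addrC [sin _ * cos _]mulrC [_ * sin (k%:~R * x)]mulrC eqxx.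
Qed.

Lemma expiN k (x : R) : expi (- k) x = conjc (expi k x).
Proof. by rewrite /expi rmorphN/= mulNr cosN sinN. Qed.

Lemma nc_expi k (x : R) : nc (expi k x) = 1.
Proof. by rewrite /expi /= cos2Dsin2 sqrtr1. Qed.

Lemma is_derive_mull (r x : R) : is_derive x 1 ( *%R r) r.
Proof.
by apply: (is_derive_eq (is_deriveZ r (is_derive_id x (1 : R)))); exact: mulr1.
Qed.

Lemma is_derive_cosM (r x : R) :
  is_derive x 1 (fun y : R => cos (r * y)) (- r * sin (r * x)).
Proof.
apply: (is_derive_eq (is_derive1_comp (is_derive_cos (r * x)) (is_derive_mull r x))).
by rewrite mulrC mulrN mulNr.
Qed.

Lemma is_derive_sinM (r x : R) :
  is_derive x 1 (fun y : R => sin (r * y)) (r * cos (r * x)).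
Proof.
apply: (is_derive_eq (is_derive1_comp (is_derive_sin (r * x)) (is_derive_mull r x))).
by rewrite mulrC.
Qed.

Lemma continuous_cosM (r : R) : continuous (fun x => cos (r * x)).
Proof.
move=> x; apply: continuous_comp; last exact: continuous_cos.
exact: mulrl_continuous.
Qed.

Lemma continuous_sinM (r : R) : continuous (fun x => sin (r * x)).
Proof.
move=> x; apply: continuous_comp; last exact: continuous_sin.
exact: mulrl_continuous.
Qed.

Lemma measurable_cosM (D : set (measurableTypeR R)) (r : R) : measurable_fun D (fun x => cos (r * x)).
Proof.
apply: measurable_funTS; apply: continuous_measurable_fun; exact: continuous_cosM.
Qed.

Lemma measurable_sinM (D : set (measurableTypeR R)) (r : R) : measurable_fun D (fun x => sin (r * x)).
Proof.
apply: measurable_funTS; apply: continuous_measurable_fun; exact: continuous_sinM.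
Qed.

Lemma circle_integrable_cosM f (r : R) : circle_integrable f ->
  circle_integrable (fun x => f x * cos (r * x)).
Proof.
move=> If; apply: (circle_integrableM If) => [|x _]; first exact: measurable_cosM.
exact: cos_max.
Qed.

Lemma circle_integrable_sinM f (r : R) : circle_integrable f ->
  circle_integrable (fun x => f x * sin (r * x)).
Proof.
move=> If; apply: (circle_integrableM If) => [|x _]; first exact: measurable_sinM.
exact: sin_max.
Qed.

Lemma cintegrable_expiM k v : cintegrable v -> cintegrable (fun x => expi k x * v x).
Proof.
move=> [v1 v2]; split.
- apply: (eq_circle_integrable _ (circle_integrableB
    (circle_integrable_cosM k%:~R v1) (circle_integrable_sinM k%:~R v2))) => x /=.
  by rewrite /expi; case: (v x) => a b /=; rewrite mulrC [b * _]mulrC.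
- apply: (eq_circle_integrable _ (circle_integrableD
    (circle_integrable_cosM k%:~R v2) (circle_integrable_sinM k%:~R v1))) => x /=.
  by rewrite /expi; case: (v x) => a b /=; rewrite mulrC [a * _]mulrC.
Qed.

Lemma cintegrable1 : cintegrable (fun=> 1 : R[i]).
Proof. by split; apply: continuous_circle_integrable => x; exact: cvg_cst. Qed.

Lemma cintegrable_expi k : @cintegrable R (expi k).
Proof.
have := cintegrable_expiM k cintegrable1.
by under eq_fun do rewrite mulr1.
Qed.

Lemma sin_zpi k : sin (k%:~R * pi) = 0 :> R.
Proof.
have H n : sin (n%:R * pi) = 0 :> R.
  elim: n => [|n IH]; first by rewrite mul0r sin0.
  by rewrite -natr1 mulrDl mul1r sinDpi IH oppr0.
case: k => n; first exact: H.
by rewrite NegzE rmorphN/= mulNr sinN H oppr0.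
Qed.

Lemma FTC_circle f (F : R -> R) : continuous f ->
  (forall x : R, is_derive x 1 F (f x)) ->
  \int[mu]_(x in circle R) f x = F pi - F (- pi).
Proof.
move=> cf dF.
have cF : continuous F.
  move=> x; apply: differentiable_continuous; apply/derivable1_diffP.
  by have [] := dF x.
rewrite /Rintegral (@continuous_FTC2 _ _ F) ?EFinB//.
- by rewrite (lt_trans _ (pi_gt0 R))// oppr_lt0 pi_gt0.
- by apply: continuous_subspaceT => x; exact: cf.
- split.
  + by move=> x _; have [] := dF x.
  + by apply: cvg_at_right_filter; exact: cF.
  + by apply: cvg_at_left_filter; exact: cF.
- by move=> x _; rewrite derive1E; apply: derive_val.
Qed.

Lemma circle_integral_cosM k : k != 0 ->
  \int[mu]_(x in circle R) cos (k%:~R * x) = 0.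
Proof.
move=> k0; have k0' : k%:~R != 0 :> R by rewrite intr_eq0.
have D (x : R) : is_derive x 1 (fun y : R => k%:~R^-1 * sin (k%:~R * y))
    (cos (k%:~R * x)).
  apply: (is_derive_eq (is_deriveZ k%:~R^-1 (is_derive_sinM k%:~R x))).
  by rewrite /GRing.scale/= mulrA mulVf ?mul1r.
by rewrite (FTC_circle (@continuous_cosM _) D) mulrN sinN sin_zpi; ring.
Qed.

Lemma circle_integral_sinM k : \int[mu]_(x in circle R) sin (k%:~R * x) = 0.
Proof.
have [->|k0] := eqVneq k 0.
  under eq_Rintegral do rewrite mul0r sin0.
  by rewrite circle_integral_cst mul0r.
have k0' : k%:~R != 0 :> R by rewrite intr_eq0.
have D (x : R) : is_derive x 1 (fun y : R => - k%:~R^-1 * cos (k%:~R * y))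
    (sin (k%:~R * x)).
  apply: (is_derive_eq (is_deriveZ (- k%:~R^-1) (is_derive_cosM k%:~R x))).
  by rewrite /GRing.scale/= mulrA mulrNN mulVf ?mul1r.
by rewrite (FTC_circle (@continuous_sinM _) D) mulrN cosN subrr.
Qed.

Lemma cintegral_expi k : cintegral (expi k) = (k == 0)%:R * (pi *+ 2)%:C :> R[i].
Proof.
rewrite /cintegral /= circle_integral_sinM.
have [->|k0] := eqVneq k 0.
  under eq_Rintegral do rewrite mul0r cos0.
  by rewrite circle_integral_cst !mul1r.
by rewrite circle_integral_cosM// mul0r.
Qed.

Lemma fourierD v w k : cintegrable v -> cintegrable w ->
  fourier (fun x => v x + w x) k = fourier v k + fourier w k.
Proof.
move=> Iv Iw; rewrite /fourier -mulrDr -cintegralD; try exact: cintegrable_expiM.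
by congr (_ * _); apply: eq_cintegral => x; rewrite mulrDr.
Qed.

Lemma fourierZ (c : R[i]) v k : cintegrable v ->
  fourier (fun x => c * v x) k = c * fourier v k.
Proof.
move=> Iv; rewrite /fourier mulrCA -(cintegralZ c (cintegrable_expiM (- k) Iv)).
by congr (_ * _); apply: eq_cintegral => x; rewrite mulrCA.
Qed.

Lemma fourier_sum (I : Type) (s : seq I) (F : I -> R -> R[i]) k :
  (forall i, cintegrable (F i)) ->
  fourier (fun x => \sum_(i <- s) F i x) k = \sum_(i <- s) fourier (F i) k.
Proof.
move=> IF; rewrite /fourier -mulr_sumr -cintegral_sum => [|i].
  by congr (_ * _); apply: eq_cintegral => x; rewrite mulr_sumr.
exact: cintegrable_expiM.
Qed.

Lemma fourier_expiM j v k :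
  fourier (fun x => expi j x * v x) k = fourier v (k - j).
Proof.
rewrite /fourier; congr (_ * _); apply: eq_cintegral => x.
by rewrite mulrA -expiD; congr (expi _ _ * _); ring.
Qed.

Lemma fourier_expi j k : fourier (expi j) k = (j == k)%:R :> R[i].
Proof.
rewrite /fourier; under eq_cintegral do rewrite -expiD.
rewrite cintegral_expi addrC subr_eq0.
case: (j == k); last by rewrite mul0r mulr0.
by rewrite mul1r -rmorphM/= mulVf// mulrn_eq0/= gt_eqF// pi_gt0.
Qed.

Lemma fourier_trig_sumM N (c : int -> R[i]) v k : cintegrable v ->
  fourier (fun x => trig_sum N c x * v x) k =
  \sum_(j <- freqs N) c j * fourier v (k - j).
Proof.
move=> Iv; have -> : (fun x => trig_sum N c x * v x) =
    fun x => \sum_(j <- freqs N) c j * (expi j x * v x).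
  by apply/funext => x; rewrite /trig_sum mulr_suml; under eq_bigr do rewrite -mulrA.
rewrite fourier_sum => [|j]; last exact/cintegrableZ/cintegrable_expiM.
apply: eq_bigr => j _; rewrite fourierZ; last exact: cintegrable_expiM.
by rewrite fourier_expiM.
Qed.

Lemma cintegrable_trig_sum N (c : int -> R[i]) : cintegrable (trig_sum N c).
Proof. by apply: cintegrable_sum => j; exact/cintegrableZ/cintegrable_expi. Qed.

Lemma fourier_trig_sum N (c : int -> R[i]) k :
  fourier (trig_sum N c) k = if `|k| <= N%:Z then c k else 0.
Proof.
rewrite /trig_sum fourier_sum => [|j]; last exact/cintegrableZ/cintegrable_expi.
under eq_bigr => j _ do rewrite (fourierZ _ _ (cintegrable_expi j)) fourier_expi.
rewrite -mem_freqs; case: ifPn => kN.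
  rewrite (sum_freqs_delta kN)//= ?eqxx ?mulr1// => j /negbTE->.
  by rewrite mulr0.
rewrite big1_seq// => j /= jN; case: eqVneq => [jk|]; rewrite ?mulr0//.
by move: kN; rewrite -jk jN.
Qed.

Lemma fourier_conj f k : circle_integrable f ->
  fourier (toC f) (- k) = conjc (fourier (toC f) k).
Proof.
have conjM (a b : R[i]) : conjc (a * b) = conjc a * conjc b by exact: rmorphM.
move=> If; rewrite /fourier conjM -cintegral_conj.
  congr (_ * _); first by rewrite conjc_real.
  apply: eq_cintegral => x; rewrite conjM opprK -expiN opprK.
  by rewrite /toC conjc_real.
exact/cintegrable_expiM/cintegrable_toC.
Qed.

Lemma eq_fourier v w k : v =1 w -> fourier v k = fourier w k.
Proof. by move=> /funext ->. Qed.

Lemma fourier_toCZ (r : R) f k : circle_integrable f ->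
  fourier (toC (fun x => r * f x)) k = r%:C * fourier (toC f) k.
Proof.
move=> If; rewrite -fourierZ; last exact: cintegrable_toC.
by apply: eq_fourier => x; rewrite /toC rmorphM.
Qed.

Lemma fourier_toCD f g k : circle_integrable f -> circle_integrable g ->
  fourier (toC (fun x => f x + g x)) k = fourier (toC f) k + fourier (toC g) k.
Proof.
move=> If Ig; rewrite -fourierD; try exact: cintegrable_toC.
by apply: eq_fourier => x; rewrite /toC rmorphD.
Qed.

Lemma fourier_toCB f g k : circle_integrable f -> circle_integrable g ->
  fourier (toC (fun x => f x - g x)) k = fourier (toC f) k - fourier (toC g) k.
Proof.
move=> If Ig; apply/eqP; rewrite eq_sym subr_eq -fourier_toCD//.
  by apply/eqP/eq_fourier => x; rewrite /toC subrK.
exact: circle_integrableB.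
Qed.

Lemma fourier_re_im f k : circle_integrable f ->
  fourier (toC f) k = ((pi *+ 2)^-1 * \int[mu]_(x in circle R) (f x * cos (k%:~R * x)))
   +i* (- ((pi *+ 2)^-1 * \int[mu]_(x in circle R) (f x * sin (k%:~R * x)))).
Proof.
move=> If; rewrite /fourier /cintegral; apply/eqP; rewrite eq_complex /=.
rewrite !mul0r subr0 addr0 -mulrN; apply/andP; split; apply/eqP; congr (_ * _).
  apply: eq_Rintegral => x _; rewrite mulr0 subr0 rmorphN/= mulNr cosN.
  by rewrite mulrC.
rewrite -mulN1r -RintegralZl; last exact: circle_integrable_sinM.
  apply: eq_Rintegral => x _; rewrite mulr0 add0r rmorphN/= mulNr sinN.
  by rewrite mulNr mulN1r mulrC.
exact: measurable_circle.
Qed.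

(** The factor [2] comes from bounding the real and imaginary parts separately. *)
Lemma nc_fourier_le f k : circle_integrable f ->
  nc (fourier (toC f) k) <= 2 * (pi *+ 2)^-1 * \int[mu]_(x in circle R) `|f x|.
Proof.
move=> If; rewrite fourier_re_im//; apply: le_trans (nc_le_ReIm _) _ => /=.
have p0 : 0 <= (pi *+ 2)^-1 :> R by rewrite invr_ge0 mulrn_wge0// pi_ge0.
rewrite normrN !normrM (ger0_norm p0) -mulrA mulrDl mul1r.
have Ia : circle_integrable (fun x => `|f x|).
  exact: circle_integrable_norm.
have mc := @measurable_circle R.
apply: lerD; apply: ler_wpM2l => //.
- have Ic := circle_integrable_cosM k%:~R If.
  apply: le_trans (le_normr_Rintegral mc Ic) _.
  apply: le_Rintegral => //; first exact: circle_integrable_norm.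
  by move=> x _; rewrite normrM ler_piMr// cos_max.
- have Ic := circle_integrable_sinM k%:~R If.
  apply: le_trans (le_normr_Rintegral mc Ic) _.
  apply: le_Rintegral => //; first exact: circle_integrable_norm.
  by move=> x _; rewrite normrM ler_piMr// sin_max.
Qed.

End Fourier.

(** * Uniqueness of Fourier coefficients *)

(** The polynomials [(1 - y ^ n) ^ (2 ^ n)] tend on [[0, 1]] to the indicator of
    [y < 1 / 2] and stay in [[0, 1]]: by Bernoulli's inequality, with
    [2 ^ n y ^ n = (2 y) ^ n], they lie above [1 - (2 y) ^ n] and below
    [(2 y) ^ (- n)]. *)
Section Threshold.
Context {R : realType}.
Implicit Types (a y : R).

Lemma expr_1B_ge a N : 0 <= a <= 1 -> 1 - N%:R * a <= (1 - a) ^+ N.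
Proof.
move=> /andP[a0 a1]; elim: N => [|N IH]; first by rewrite mul0r subr0 expr0.
rewrite exprS -natr1; have : (1 - a) * (1 - N%:R * a) <= (1 - a) * (1 - a) ^+ N.
  by rewrite ler_wpM2l// subr_ge0.
apply: le_trans; rewrite -subr_ge0.
have -> : (1 - a) * (1 - N%:R * a) - (1 - (N%:R + 1) * a) = N%:R * a ^+ 2 by ring.
by rewrite mulr_ge0// sqr_ge0.
Qed.

Lemma expr_1B_le a N : 0 <= a <= 1 -> (1 - a) ^+ N * (1 + N%:R * a) <= 1.
Proof.
move=> /andP[a0 a1]; elim: N => [|N IH]; first by rewrite mul0r addr0 expr0 mul1r.
apply: le_trans IH; rewrite exprSr -mulrA ler_wpM2l ?exprn_ge0 ?subr_ge0//.
rewrite -natr1 -subr_ge0.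
have -> : 1 + N%:R * a - (1 - a) * (1 + (N%:R + 1) * a) = (N%:R + 1) * a ^+ 2 by ring.
by rewrite mulr_ge0 ?sqr_ge0// addr_ge0.
Qed.

Lemma threshold_itv y n : 0 <= y <= 1 -> 0 <= (1 - y ^+ n) ^+ (2 ^ n) <= 1.
Proof.
move=> /andP[y0 y1]; have yn1 : y ^+ n <= 1 by rewrite exprn_ile1.
have yn0 : 0 <= y ^+ n by rewrite exprn_ge0.
rewrite exprn_ge0 ?subr_ge0//= exprn_ile1 ?subr_ge0//.
by rewrite gerBl.
Qed.

Lemma threshold_cvg1 y : 0 <= y < 2^-1 ->
  (1 - y ^+ n) ^+ (2 ^ n) @[n --> \oo] --> (1 : R).
Proof.
move=> /andP[y0 y2]; have y1 : y <= 1 by lra.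
have h n : 1 - (2 * y) ^+ n <= (1 - y ^+ n) ^+ (2 ^ n) <= 1.
  have /andP[_ ->] := @threshold_itv y n (introT andP (conj y0 y1)).
  rewrite andbT exprMn -natrX; apply: expr_1B_ge.
  by rewrite exprn_ge0// exprn_ile1.
apply: (squeeze_cvgr (f := fun n => 1 - (2 * y) ^+ n) (h := fun=> 1)).
- by apply: nearW => n; exact: h.
- rewrite -[X in _ --> X]subr0; apply: cvgB; first exact: cvg_cst.
  by apply: cvg_expr; rewrite ger0_norm ?mulr_ge0//; lra.
- exact: cvg_cst.
Qed.

Lemma threshold_cvg0 y : 2^-1 < y <= 1 ->
  (1 - y ^+ n) ^+ (2 ^ n) @[n --> \oo] --> (0 : R).
Proof.
move=> /andP[y2 y1]; have y0 : 0 <= y by lra.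
have h n : 0 <= (1 - y ^+ n) ^+ (2 ^ n) <= ((2 * y)^-1) ^+ n.
  have /andP[q0 _] := @threshold_itv y n (introT andP (conj y0 y1)).
  rewrite q0.
  have yn : 0 <= y ^+ n <= 1 by rewrite exprn_ge0// exprn_ile1.
  have := expr_1B_le (2 ^ n) yn; rewrite natrX -exprMn.
  have p : 0 < (2 * y) ^+ n by rewrite exprn_gt0//; lra.
  rewrite exprVn -ler_pdivlMr ?div1r; last by rewrite addr_gt0.
  move=> /le_trans; apply; rewrite lef_pV2 ?posrE ?addr_gt0//; lra.
apply: (squeeze_cvgr (f := fun=> 0) (h := fun n => (2 * y)^-1 ^+ n)).
- by apply: nearW => n; exact: h.
- exact: cvg_cst.
- apply: cvg_expr; rewrite ger0_norm ?invr_ge0; last lra.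
  by rewrite invf_lt1; lra.
Qed.

End Threshold.

Section Uniqueness.
Context {R : realType}.
Notation mu := (@lebesgue_measure R).
Implicit Types (f g h : R -> R).

Definition annihilated g : Prop :=
  circle_integrable g /\ forall k, fourier (toC g) k = 0.

Lemma annihilated0 : annihilated (fun=> 0).
Proof.
split; first by apply: continuous_circle_integrable => x; exact: cvg_cst.
move=> k; rewrite /fourier.
under eq_cintegral do rewrite /toC mulr0.
by rewrite cintegral0 mulr0.
Qed.

Lemma annihilatedD f g : annihilated f -> annihilated g ->
  annihilated (fun x => f x + g x).
Proof.
move=> [If f0] [Ig g0]; split => [|k]; first exact: circle_integrableD.
rewrite (@eq_fourier _ _ (fun x => toC f x + toC g x)).
  by rewrite fourierD ?f0 ?g0 ?addr0//; exact: cintegrable_toC.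
by move=> x; rewrite /toC rmorphD.
Qed.

Lemma annihilatedZ (r : R) g : annihilated g -> annihilated (fun x => r * g x).
Proof.
move=> [Ig g0]; split => [|k]; first exact: circle_integrableZ.
rewrite (@eq_fourier _ _ (fun x => r%:C * toC g x)).
  by rewrite fourierZ ?g0 ?mulr0//; exact: cintegrable_toC.
by move=> x; rewrite /toC rmorphM.
Qed.

(** Multiplying by a frequency-one wave only shifts Fourier coefficients. *)
Lemma annihilated_cos (m : R) g : annihilated g ->
  annihilated (fun x => cos (x - m) * g x).
Proof.
move=> [Ig g0]; split => [|k].
  apply: (@eq_circle_integrable _ (fun x =>
     cos m * (g x * cos (1 * x)) + sin m * (g x * sin (1 * x)))).
    by move=> x; rewrite cosB !mul1r; ring.
  by apply: circle_integrableD; apply: circle_integrableZ;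
    [exact: circle_integrable_cosM|exact: circle_integrable_sinM].
pose c : R[i] := (cos m / 2) +i* (- (sin m / 2)).
rewrite (@eq_fourier _ _ (fun x => c * (expi 1 x * toC g x) +
    conjc c * (expi (-1) x * toC g x))).
  have Ie j : cintegrable (fun x => expi j x * toC g x).
    exact/cintegrable_expiM/cintegrable_toC.
  rewrite fourierD ?fourierZ ?fourier_expiM ?g0 ?mulr0 ?addr0//;
  exact: cintegrableZ.
move=> x; rewrite expiN /toC /expi mul1r; apply/eqP; rewrite eq_complex /=.
by rewrite cosB; apply/andP; split; apply/eqP; field.
Qed.

Lemma annihilated_poly (m : R) (p : {poly R}) h : annihilated h ->
  annihilated (fun x => p.[cos (x - m)] * h x).
Proof.
move=> h0; elim/poly_ind: p => [|p c IH].
  by under eq_fun do rewrite horner0 mul0r; exact: annihilated0.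
under eq_fun do rewrite hornerMXaddC mulrDl mulrAC mulrC.
exact/annihilatedD/annihilatedZ/h0/annihilated_cos.
Qed.

(** An affine function of [cos (x - m) - cos r] with values in [[0, 1]], below [1 / 2]
    exactly on the arc of centre [m] and radius [r]; with [m = (b - pi) / 2] and
    [r = (b + pi) / 2] that arc is [(- pi, b)]. *)
Definition arc_poly (b : R) : {poly R} :=
  (2^-1 + cos ((b + pi) / 2) / 4)%:P - 4^-1 *: 'X.

(** The product form shows on which side of [1 / 2] the value lies: on
    [(- pi, pi)] the first sine is positive and the second has the sign of [b - x]. *)
Lemma horner_arc_poly b x : (arc_poly b).[cos (x - (b - pi) / 2)] =
  2^-1 - sin ((x + pi) / 2) * sin ((b - x) / 2) / 2.
Proof.
rewrite /arc_poly hornerD hornerN hornerZ hornerX hornerC.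
have -> : x - (b - pi) / 2 = (x + pi) / 2 - (b - x) / 2 by field.
have -> : (b + pi) / 2 = (x + pi) / 2 + (b - x) / 2 by field.
by rewrite cosB cosD; field.
Qed.

Lemma arc_poly_itv b x : 0 <= (arc_poly b).[cos (x - (b - pi) / 2)] <= 1.
Proof.
rewrite /arc_poly hornerD hornerN hornerZ hornerX hornerC.
have /andP[c1 c2] : -1 <= cos (x - (b - pi) / 2) <= 1 by rewrite cos_geN1 cos_le1.
have /andP[d1 d2] : -1 <= cos ((b + pi) / 2) <= 1 by rewrite cos_geN1 cos_le1.
by apply/andP; split; lra.
Qed.

Lemma ae_neq (a : R) : {ae mu, forall x, x != a}.
Proof.
exists [set a]; split; [exact: measurable_set1|exact: lebesgue_measure_set1|].
by move=> x /= /negP; rewrite negbK => /eqP.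
Qed.

(** [h] is orthogonal to polynomials in [cos (x - m)] that converge boundedly to the
    indicator of the arc. *)
Lemma annihilated_initial_arc h (b : R) : annihilated h -> - pi < b < pi ->
  \int[mu]_(x in `]- pi, b]) h x = 0.
Proof.
move=> h0 /andP[b1 b2]; have mc := @measurable_circle R.
pose q n x := (1 - (arc_poly b).[cos (x - (b - pi) / 2)] ^+ n) ^+ (2 ^ n).
have q0 n : annihilated (fun x => q n x * h x).
  have := annihilated_poly ((b - pi) / 2) ((1 - (arc_poly b) ^+ n) ^+ (2 ^ n)) h0.
  congr annihilated; apply/funext => x.
  by rewrite horner_exp hornerD hornerN horner_exp hornerC.
have iq0 n : (\int[mu]_(x in circle R) (q n x * h x)%:E)%E = 0%E.
  have [Iq /(_ 0)] := q0 n; rewrite fourier_re_im// => -[+ _] => /eqP.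
  rewrite mulf_eq0 invr_eq0 mulrn_eq0 /= gt_eqF ?pi_gt0//= => /eqP.
  under eq_Rintegral do rewrite mul0r cos0 mulr1.
  rewrite /Rintegral => e; rewrite -[LHS]fineK ?e//.
  exact: integrable_fin_num.
pose A : set (measurableTypeR R) := `]- pi, b]%classic.
have mA : measurable A by exact: measurable_itv.
have AC : A `<=` circle R.
  move=> x; rewrite /A /circle /= !in_itv/= => /andP[x1 x2].
  by rewrite ltW//= ltW// (le_lt_trans x2).
have Ih : circle_integrable h by case: h0.
have mh := circle_integrable_measurable Ih.
have cv (x : R) : x != - pi -> x != pi -> x != b -> circle R x ->
    (q n x * h x)%:E @[n --> \oo] --> (((h \_ A) x)%:E : \bar R).
  move=> xl xr xb; rewrite /circle /= in_itv/= => /andP[x1 x2].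
  have {}x1 : - pi < x by rewrite lt_neqAle eq_sym xl.
  have {}x2 : x < pi by rewrite lt_neqAle xr.
  have s1 : 0 < sin ((x + pi) / 2) by apply: sin_gt0_pi; apply/andP; split; lra.
  apply: cvg_EFin; first exact: nearW.
  rewrite patchE; case: ifPn => [|] xA.
  - rewrite -[X in _ --> X]mul1r; apply: cvgM; last exact: cvg_cst.
    apply: threshold_cvg1; have /andP[-> _] := arc_poly_itv b x.
    move: xA; rewrite inE /A /= in_itv/= => /andP[_ xb'].
    have {}xb' : x < b by rewrite lt_neqAle xb.
    have s2 : 0 < sin ((b - x) / 2) by apply: sin_gt0_pi; apply/andP; split; lra.
    by rewrite horner_arc_poly; have := mulr_gt0 s1 s2; lra.
  - rewrite -[X in _ --> X](mul0r (h x)); apply: cvgM; last exact: cvg_cst.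
    apply: threshold_cvg0; have /andP[_ ->] := arc_poly_itv b x; rewrite andbT.
    have bx : b < x.
      rewrite ltNge; apply: contra xA => bx.
      by rewrite inE /A /= in_itv/= x1 bx.
    have s2 : 0 < sin ((x - b) / 2) by apply: sin_gt0_pi; apply/andP; split; lra.
    rewrite horner_arc_poly (_ : (b - x) / 2 = - ((x - b) / 2)); last by field.
    by rewrite sinN mulrN; have := mulr_gt0 s1 s2; lra.
have := @dominated_convergence _ _ _ mu (circle R) mc (fun n x => (q n x * h x)%:E)
  (fun x => ((h \_ A) x)%:E) (fun x => `|h x|%:E).
case.
- by move=> n; case: (q0 n) => /integrableP[].
- apply/measurable_EFinP; apply/(measurable_restrict _ mA mc).
  by apply: measurable_funS mh => // x [].
- have FF : Filter (nbhs (almost_everywhere mu)) := ae_filter_ringOfSetsType mu.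
  have /(_ FF FF) := filterI (filterI (ae_neq (- pi)) (ae_neq pi)) (ae_neq b).
  by apply: filterS => x [[? ?] ?] ?; exact: cv.
- exact: circle_integrable_norm.
- apply: aeW => x n _; rewrite lee_fin normrM ler_piMl//.
  have /andP[? ?] := threshold_itv n (arc_poly_itv b x).
  by rewrite ger0_norm.
move=> _ _ /(cvg_lim (@ereal_hausdorff R)).
rewrite (_ : (fun n => _) = cst 0%E); last by apply/funext => n; exact: iq0.
rewrite lim_cst// => e.
 have : \int[mu]_(x in circle R) (h \_ A) x = 0 by rewrite /Rintegral -e.
by rewrite -Rintegral_mkcondr setIidr.
Qed.

(** The primitive of [h] vanishes on [(- pi, pi)], hence so does its derivative, which is
    [h] almost everywhere. *)
Lemma annihilated_ae0 h : annihilated h -> {ae mu, forall x, circle R x -> h x = 0}.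
Proof.
move=> h0; have Ih : circle_integrable h by case: h0.
have mc := @measurable_circle R.
pose f := h \_ (circle R).
have IfT : mu.-integrable setT (EFin \o f).
  by move/(integrable_mkcond _ mc) : Ih; rewrite restrict_EFin.
have lf : locally_integrable [set: R] f.
  by apply: open_integrable_locally => //; exact: openT.
have I y : mu.-integrable [set` Interval (BRight (- pi : R)) (BRight y)] (EFin \o f).
  apply: integrableS IfT => //; exact: measurable_itv.
have := FTC1 I lf.
have FF : Filter (nbhs (almost_everywhere mu)) := ae_filter_ringOfSetsType mu.
have : {ae mu, forall x : R, x != - pi /\ x != pi}.
  exact: (filterI (ae_neq (- pi)) (ae_neq pi)).
apply: filterS2 => x [xl xr] fx; rewrite /circle /= in_itv/= => /andP[x1 x2].
have {}x1 : - pi < x by rewrite lt_neqAle eq_sym xl.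
have {}x2 : x < pi by rewrite lt_neqAle xr.
have {fx}[_] := fx x1.
set F := fun y => _; rewrite (_ : f x = h x); last first.
  by rewrite /f patchE mem_set// /circle /= in_itv/= !ltW.
move=> <-.
have F0 y : - pi < y < pi -> F y = 0.
  move=> /andP[y1 y2]; rewrite /F -[RHS](annihilated_initial_arc h0 (b := y)) ?y1//.
  apply: eq_Rintegral => z; rewrite inE /= in_itv/= => /andP[z1 z2].
  by rewrite /f patchE mem_set// /circle /= in_itv/= ltW//= ltW// (le_lt_trans z2).
rewrite /derive1; apply/cvg_lim; first exact: Rhausdorff.
rewrite -[X in _ --> X](scaler0 R (0 : R)).
apply: cvg_trans (near_eq_cvg _) (cvg_cst _).
near=> t; rewrite !F0 ?subrr ?scaler0 ?x1//.
have /ltr_normlP[] : `|t| < Num.min (x + pi) (pi - x).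
  near: t; apply: dnbhs0_lt; rewrite lt_min; apply/andP; split; lra.
rewrite !lt_min => /andP[t1 t2] /andP[t3 t4]; rewrite /GRing.scale/=; apply/andP; split; lra.
Unshelve. all: by end_near. Qed.

End Uniqueness.

(** * Absolutely convergent Fourier series *)

Lemma le0_cvg0 {R : realType} (x : R) (v : nat -> R) :
  v @ \oo --> (0 : R) -> (forall n, x <= v n) -> x <= 0.
Proof.
by move=> v0 xv; apply: (ler_cvg_to (cvg_cst x) v0); apply: nearW.
Qed.

Lemma pi2_gt0 {R : realType} : 0 < pi *+ 2 :> R.
Proof. by rewrite pmulrn_lgt0 ?pi_gt0. Qed.

Section AeIntegral.
Context {R : realType}.
Notation mu := (@lebesgue_measure R).
Implicit Types (f g : R -> R).

Lemma ae_sub (P Q : R -> Prop) : (forall x, P x -> Q x) ->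
  {ae mu, forall x, P x} -> {ae mu, forall x, Q x}.
Proof. exact: (@filterS _ _ (ae_filter_ringOfSetsType mu)). Qed.

Lemma ae_eq_circle_integral f g :
  measurable_fun (circle R : set (measurableTypeR R)) f -> circle_integrable g ->
  {ae mu, forall x, circle R x -> f x = g x} ->
  circle_integrable f /\
  \int[mu]_(x in circle R) f x = \int[mu]_(x in circle R) g x.
Proof.
move=> mf Ig fg; have mc := @measurable_circle R.
have mg := circle_integrable_measurable Ig.
split.
  apply/integrableP; split; first exact/measurable_EFinP.
  have [_] : measurable_fun (circle R : set (measurableTypeR R)) (EFin \o g) /\
    (\int[mu]_(x in circle R) `|(EFin \o g) x| < +oo)%E by exact/integrableP.
  congr (_ < _)%E; apply: ae_eq_integral => //.
  - by apply: measurableT_comp => //; exact/measurable_EFinP.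
  - by apply: measurableT_comp => //; exact/measurable_EFinP.
  - by apply: ae_sub fg => x /= h cx; rewrite h.
congr fine; apply: ae_eq_integral => //; [exact/measurable_EFinP..|].
by apply: ae_sub fg => x /= h cx; rewrite h.
Qed.

Lemma ae_eq_fourier f g k :
  measurable_fun (circle R : set (measurableTypeR R)) f -> circle_integrable g ->
  {ae mu, forall x, circle R x -> f x = g x} ->
  fourier (toC f) k = fourier (toC g) k.
Proof.
move=> mf Ig fg; have [If _] := ae_eq_circle_integral mf Ig fg.
rewrite !fourier_re_im//; congr (_ * _ +i* (- (_ * _))).
- apply: (ae_eq_circle_integral _ (circle_integrable_cosM k%:~R Ig) _).2.
    exact: (circle_integrable_measurable (circle_integrable_cosM k%:~R If)).
  by apply: ae_sub fg => x h cx; rewrite h.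
- apply: (ae_eq_circle_integral _ (circle_integrable_sinM k%:~R Ig) _).2.
    exact: (circle_integrable_measurable (circle_integrable_sinM k%:~R If)).
  by apply: ae_sub fg => x h cx; rewrite h.
Qed.

End AeIntegral.

Section AbsolutelyConvergent.
Context {R : realType}.
Notation mu := (@lebesgue_measure R).
Implicit Types (f g h : R -> R) (c : int -> R[i]).

Lemma nc_trig_sumB c M n x : (M <= n)%N ->
  nc (trig_sum n c x - trig_sum M c x) <=
  \sum_(k <- freqs n) nc (c k) - \sum_(k <- freqs M) nc (c k).
Proof.
elim: n => [|n IH].
  by rewrite leqn0 => /eqP->; rewrite !subrr ComplexField.Normc.normc0.
rewrite leq_eqVlt => /predU1P[->|Mn].
  by rewrite !subrr ComplexField.Normc.normc0.
rewrite /trig_sum !sum_freqsS -/(trig_sum n c x) -/(trig_sum M c x).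
rewrite -!addrA; apply: le_trans (le_normcD _ _) _.
rewrite ComplexField.Normc.normcM nc_expi mulr1 lerD2l.
apply: le_trans (le_normcD _ _) _.
by rewrite ComplexField.Normc.normcM nc_expi mulr1 lerD2l IH.
Qed.

Lemma nc_trig_sum c n x : nc (trig_sum n c x) <= \sum_(k <- freqs n) nc (c k).
Proof.
apply: le_trans (nc_sum _ _) _; apply: ler_sum => k _.
by rewrite ComplexField.Normc.normcM nc_expi mulr1.
Qed.

Lemma conj_trig_sum c n x : (forall k, c (- k) = conjc (c k)) ->
  conjc (trig_sum n c x) = trig_sum n c x.
Proof.
move=> cN; rewrite /trig_sum (rmorph_sum (@conjc R)) -[RHS]sum_freqsN.
by apply: eq_bigr => k _; rewrite (rmorphM (@conjc R)) cN expiN.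
Qed.

Lemma continuous_Re_trig_sum c n : continuous (fun x => complex.Re (trig_sum n c x)).
Proof.
have -> : (fun x => complex.Re (trig_sum n c x)) = fun x =>
    \sum_(k <- freqs n) (complex.Re (c k) * cos (k%:~R * x) -
      complex.Im (c k) * sin (k%:~R * x)).
  apply/funext => x; rewrite /trig_sum (raddf_sum (@complex.Re R)).
  by apply: eq_bigr => k _; rewrite /expi; case: (c k).
move=> x; elim: (freqs n) => [|k t IH].
  by under eq_fun do rewrite big_nil; exact: cvg_cst.
under eq_fun do rewrite big_cons.
apply: cvgD IH; apply: cvgB; apply: cvgM; try exact: cvg_cst.
- exact: continuous_cosM.
- exact: continuous_sinM.
Qed.

(** [f] is almost everywhere the uniform limit [g] of its Fourier partial sums:
    [g] has the same coefficients as [f], and coefficients determine the function. *)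
Lemma fourier_series_ae f (c := fourier (toC f)) (A : R) : circle_integrable f ->
  (forall M, \sum_(k <- freqs M) nc (c k) <= A) ->
  exists g : R -> R, exists tail : nat -> R,
  [/\ circle_integrable g, forall x, `|g x| <= A,
     {ae mu, forall x, circle R x -> f x = g x},
     tail @ \oo --> (0 : R) &
     forall M x, nc ((g x)%:C - trig_sum M c x) <= tail M].
Proof.
move=> If cA; pose s M := \sum_(k <- freqs M) nc (c k).
have s_nd : nondecreasing_seq s.
  by move=> m n mn; apply: sum_freqs_le => // k; exact: nc_ge0.
have s_cv : cvgn s.
  by apply: nondecreasing_is_cvgn => //; exists A => _ [n _ <-]; exact: cA.
have cN k : c (- k) = conjc (c k) by exact: fourier_conj.
pose r M x := complex.Re (trig_sum M c x).
have rE M x : (r M x)%:C = trig_sum M c x by apply/conj_eq_real/conj_trig_sum.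
have rB M n x : (M <= n)%N -> `|r n x - r M x| <= s n - s M.
  move=> Mn; have -> : r n x - r M x = complex.Re (trig_sum n c x - trig_sum M c x).
    by rewrite raddfB.
  exact: le_trans (nc_Re _) (nc_trig_sumB _ _ Mn).
have rA M x : `|r M x| <= A.
  exact: le_trans (nc_Re _) (le_trans (nc_trig_sum _ _ _) (cA M)).
(* The increments of [r] are dominated by those of [s], so [r + s] is monotone. *)
have r_cv x : cvgn (r ^~ x).
  have -> : r ^~ x = (fun n => r n x + s n) \- s.
    by apply/funext => n /=; rewrite addrK.
  apply: is_cvgB; last exact: s_cv.
  apply: nondecreasing_is_cvgn.
    move=> m n mn; have := rB _ _ x mn; rewrite ler_norml => /andP[+ _]; lra.
  exists (A + A) => _ [n _ <-]; apply: lerD; last exact: cA.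
  exact: le_trans (ler_norm _) (rA n x).
pose g x := limn (r ^~ x).
have gr x : r n x @[n --> \oo] --> g x by exact: r_cv.
have gA x : `|g x| <= A.
  have h : `|r n x| @[n --> \oo] --> `|g x| by apply: cvg_norm; exact: gr.
  apply: (ler_cvg_to h (cvg_cst A)).
  by apply: nearW => n; exact: rA.
pose tail M := limn s - s M.
have tail0 : tail @ \oo --> (0 : R).
  by rewrite -[X in _ --> X](subrr (limn s)); apply: cvgB => //; exact: cvg_cst.
have gB M x : `|g x - r M x| <= tail M.
  have h : `|r n x - r M x| @[n --> \oo] --> `|g x - r M x|.
    by apply: cvg_norm; apply: cvgB; [exact: gr|exact: cvg_cst].
  apply: (ler_cvg_to h (cvg_cst (tail M))); near=> n.
  apply: le_trans (rB M n x _) _; first by near: n; exact: nbhs_infty_ge.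
  by rewrite lerD2r; exact: nondecreasing_cvgn_le.
have Ir M : circle_integrable (r M).
  exact/continuous_circle_integrable/continuous_Re_trig_sum.
have mg : measurable_fun (circle R : set (measurableTypeR R)) g.
  apply: (measurable_fun_cvg (h := r)) => [m|x _]; last exact: gr.
  exact: circle_integrable_measurable.
have Ig : circle_integrable g.
  by apply: (circle_integrable_bounded (K := A) mg) => x _; exact: gA.
have gc k : fourier (toC g) k = c k.
  apply/eqP; rewrite -subr_eq0; apply/eqP/ComplexField.Normc.eq0_normc.
  apply/eqP; rewrite eq_le nc_ge0 andbT.
  have t2 : (fun M => 2 * tail (M + `|k|)%N) @ \oo --> (0 : R).
    rewrite -[X in _ --> X](mulr0 2); apply: cvgM; first exact: cvg_cst.
    by rewrite (cvg_shiftn (`|k|%N) tail).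
  apply: (le0_cvg0 t2) => n; set M := (n + `|k|)%N.
  have -> : c k = fourier (toC (r M)) k.
    rewrite (eq_fourier _ (rE M : toC (r M) =1 trig_sum M c)) fourier_trig_sum ifT//.
    by rewrite /M; lia.
  have Igr : circle_integrable (fun x => g x - r M x) by exact: circle_integrableB.
  rewrite -fourier_toCB//; apply: le_trans (nc_fourier_le _ Igr) _; rewrite -mulrA ler_pM2l//.
  rewrite mulrC ler_pdivrMr ?pi2_gt0//.
  apply: le_trans (ler_norm _) _; apply: circle_integral_le.
    exact: circle_integrable_norm.
  by move=> x _; rewrite normr_id.
exists g, tail; split => //; last first.
  move=> M x; rewrite -rE (_ : _ - _ = (g x - r M x)%:C) ?nc_real//.
  exact/esym/rmorphB.
have : annihilated (fun x => f x - g x).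
  split; first exact: circle_integrableB.
  by move=> k; rewrite fourier_toCB// gc subrr.
move=> /annihilated_ae0; apply: ae_sub => x h /h /eqP.
by rewrite subr_eq0 => /eqP.
Unshelve. all: by end_near. Qed.

(** Term-by-term integration of the series of [f] against [h]. *)
Lemma fourier_mul_cvg f h (c := fourier (toC f)) (A : R) :
  circle_integrable f -> circle_integrable h ->
  (forall M, \sum_(k <- freqs M) nc (c k) <= A) ->
  circle_integrable (fun x => f x * h x) /\
  exists2 tail : nat -> R, tail @ \oo --> (0 : R) & forall M k,
    nc (fourier (toC (fun x => f x * h x)) k -
        \sum_(j <- freqs M) c j * fourier (toC h) (k - j)) <= tail M.
Proof.
move=> If Ih cA; have mc := @measurable_circle R.
have [g [tail [Ig gA fg tail0 gt]]] := fourier_series_ae If cA.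
have mf := circle_integrable_measurable If.
have mh := circle_integrable_measurable Ih.
have Igh : circle_integrable (fun x => g x * h x).
  apply: (eq_circle_integrable (f := fun x => h x * g x)) => [x|]; first exact: mulrC.
  apply: (circle_integrableM (K := A) Ih); first exact: circle_integrable_measurable.
  by move=> x _; exact: gA.
have mfh : measurable_fun (circle R : set (measurableTypeR R)) (fun x => f x * h x).
  exact: measurable_funM.
have fgh : {ae mu, forall x, circle R x -> f x * h x = g x * h x}.
  by apply: ae_sub fg => x e cx; rewrite e.
have [Ifh _] := ae_eq_circle_integral mfh Igh fgh; split => //.
have Iah := circle_integrable_norm Ih.
set H := \int[mu]_(x in circle R) `|h x|.
exists (fun M => 2 * (pi *+ 2)^-1 * (tail M * H)).
  rewrite -[X in _ --> X](mulr0 (2 * (pi *+ 2)^-1)); apply: cvgM; first exact: cvg_cst.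
  by rewrite -[X in _ --> X](mul0r H); apply: cvgM => //; exact: cvg_cst.
move=> M k; rewrite (ae_eq_fourier k mfh Igh fgh).
pose r x := complex.Re (trig_sum M c x).
have rE x : (r x)%:C = trig_sum M c x.
  by apply/conj_eq_real/conj_trig_sum => j; exact: fourier_conj.
have Irh : circle_integrable (fun x => r x * h x).
  apply: (eq_circle_integrable (f := fun x => h x * r x)) => [x|]; first exact: mulrC.
  apply: (circle_integrableM (K := A) Ih) => [|x _].
    apply: circle_integrable_measurable.
    exact/continuous_circle_integrable/continuous_Re_trig_sum.
  exact: le_trans (nc_Re _) (le_trans (nc_trig_sum _ _ _) (cA M)).
rewrite -fourier_trig_sumM; last exact: cintegrable_toC.
rewrite (eq_fourier (v := fun x => trig_sum M c x * toC h x)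
  (w := toC (fun x => r x * h x))); last first.
  by move=> x; rewrite /toC rmorphM /= -rE.
rewrite -fourier_toCB//.
have IB := circle_integrableB Igh Irh.
apply: le_trans (nc_fourier_le _ IB) _.
apply: ler_wpM2l; first by rewrite mulr_ge0// invr_ge0 ltW// pi2_gt0.
rewrite /H -RintegralZl//; apply: le_Rintegral => //.
- exact: circle_integrable_norm.
- exact: circle_integrableZ.
- move=> x _; rewrite -mulrBl normrM ler_wpM2r//.
  rewrite -nc_real (_ : _%:C = (g x)%:C - trig_sum M c x); first exact: gt.
  by rewrite -rE; exact: rmorphB.
Qed.

(** Integrating [f] against its own series computes the zeroth coefficient of [f ^ 2]:
    it is the limit of the sums of [|c k| ^ 2]. *)
Lemma parseval_le f (c := fourier (toC f)) (A B : R) : circle_integrable f ->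
  (forall M, \sum_(k <- freqs M) nc (c k) <= A) ->
  (forall M, \sum_(k <- freqs M) nc (c k) ^+ 2 <= B) ->
  circle_integrable (fun x => f x ^+ 2) /\
  \int[mu]_(x in circle R) (f x ^+ 2) <= pi *+ 2 * B.
Proof.
move=> If cA cB; have [Iff [tail tail0 ft]] := fourier_mul_cvg If If cA.
have IE : circle_integrable (fun x => f x ^+ 2).
  by apply: eq_circle_integrable Iff => x; rewrite expr2.
split => //; set I := \int[mu]_(x in circle R) _.
have p2 := @pi2_gt0 R.
rewrite -(ler_pdivrMl _ _ p2) -subr_ge0 -oppr_le0 opprB; apply: (le0_cvg0 tail0) => M.
apply: le_trans (ft M 0); apply: le_trans (nc_Re _).
have I0 : complex.Re (fourier (toC (fun x => f x * f x)) 0) = (pi *+ 2)^-1 * I.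
  rewrite fourier_re_im//; congr (_ * _); apply: eq_Rintegral => x _.
  by rewrite mul0r cos0 mulr1 expr2.
rewrite ReB I0; apply: le_trans (ler_norm _); apply: lerB; first exact: lexx.
apply: le_trans (cB M); rewrite (raddf_sum (@complex.Re R)).
apply: ler_sum => j _; rewrite sub0r fourier_conj//.
by rewrite nc_sqr /c; case: (fourier _ _) => a b /=; rewrite mulrN opprK -!expr2.
Qed.

End AbsolutelyConvergent.

Section L2.
Context {R : realType}.
Notation mu := (@lebesgue_measure R).
Implicit Types (f g h : R -> R).

Lemma L2_circle_measurable f : L2 f ->
  measurable_fun (circle R : set (measurableTypeR R)) f.
Proof.
move=> /sub_Lfun_mfun; rewrite inE /= => mf.
exact: (measurable_restrictT f (@measurable_circle R)).2.
Qed.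

Lemma L2_integrable_sqr f : L2 f -> circle_integrable (fun x => f x ^+ 2).
Proof.
move=> /Lfun2_integrable_sqr If; apply/integrable_mkcond; first exact: measurable_circle.
apply: (eq_integrable measurableT) If => x _ /=.
by rewrite !patchE; case: ifP => //= _; rewrite expr0n.
Qed.

Lemma L2normE f : measurable_fun (circle R : set (measurableTypeR R)) f ->
  circle_integrable (fun x => f x ^+ 2) ->
  L2norm f = (Num.sqrt (\int[mu]_(x in circle R) (f x ^+ 2)))%:E.
Proof.
move=> mf If; rewrite /L2norm unlock /=.
have -> : (\int[mu]_x `|(f \_ (circle R)) x|%:E `^ 2)%E =
   (\int[mu]_(x in circle R) (f x ^+ 2))%:E.
  rewrite /Rintegral fineK; last exact: (integrable_fin_num (@measurable_circle R) If).
  rewrite [RHS]integral_mkcond; apply: eq_integral => x _.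
  rewrite poweR_EFin powR_mulrn// !patchE real_normK ?num_real//.
  by case: ifP => //= _; rewrite expr0n.
by rewrite poweR_EFin powR12_sqrt// Rintegral_ge0// => x _; exact: sqr_ge0.
Qed.

Lemma L2P f : L2 f <->
  measurable_fun (circle R : set (measurableTypeR R)) f /\
  circle_integrable (fun x => f x ^+ 2).
Proof.
split=> [Lf|[mf If]].
  by split; [exact: L2_circle_measurable|exact: L2_integrable_sqr].
rewrite /L2 inE; apply/andP; split; rewrite inE /=.
  exact: (measurable_restrictT f (@measurable_circle R)).1.
by have := L2normE mf If; rewrite /L2norm /finite_norm => ->; exact: ltry.
Qed.

Lemma L2_integrable f : L2 f -> circle_integrable f.
Proof.
move=> Lf; have I1 : circle_integrable (fun=> 1 : R).
  by apply: continuous_circle_integrable => x; exact: cvg_cst.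
apply: (le_integrable (@measurable_circle R) _ _
   (circle_integrableD I1 (L2_integrable_sqr Lf))).
  by apply/measurable_EFinP; exact: (L2_circle_measurable Lf).
move=> x _ /=; rewrite lee_fin [X in _ <= X]ger0_norm ?addr_ge0 ?sqr_ge0//.
have := sqr_ge0 (`|f x| - 1); rewrite sqrrB real_normK ?num_real//.
have := normr_ge0 (f x); lra.
Qed.

Lemma L2Z (a : R) f : L2 f -> L2 (fun x => a * f x).
Proof.
move=> /L2P[mf If]; apply/L2P; split; first exact: measurable_funM.
apply: eq_circle_integrable (circle_integrableZ (a ^+ 2) If) => x.
by rewrite exprMn.
Qed.

Lemma L2D f g : L2 f -> L2 g -> L2 (fun x => f x + g x).
Proof.
move=> /L2P[mf If] /L2P[mg Ig]; apply/L2P; split; first exact: measurable_funD.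
apply: (le_integrable (@measurable_circle R) _ _
   (circle_integrableZ 2 (circle_integrableD If Ig))).
  by apply/measurable_EFinP; apply: measurable_funX; exact: measurable_funD.
move=> x _ /=; rewrite lee_fin !ger0_norm ?sqr_ge0//.
  by have := sqr_ge0 (f x - g x); lra.
by rewrite mulr_ge0// addr_ge0 ?sqr_ge0.
Qed.

Lemma L2B f g : L2 f -> L2 g -> L2 (fun x => f x - g x).
Proof.
move=> Lf /(L2Z (-1)) Lg; have := L2D Lf Lg.
by under eq_fun do rewrite mulN1r.
Qed.

Lemma continuous_L2 f : continuous f -> L2 f.
Proof.
move=> cf; apply/L2P; split.
  exact: (circle_integrable_measurable (continuous_circle_integrable cf)).
apply: continuous_circle_integrable => x.
by apply: (@continuous_comp _ _ _ f (fun y => y ^+ 2)); [exact: cf|exact: exprn_continuous].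
Qed.

End L2.

(** * Sobolev bounds on windows of coefficients *)

Section SobolevBounds.
Context {R : realType}.
Implicit Types (c d : int -> R[i]) (mu s : R).

(** Bounding all symmetric partial sums amounts to bounding the squared norm and
    keeps every sum finite. *)
Definition sobolev_bound s c (B : R) : Prop :=
  forall M, \sum_(k <- freqs M) (1 + k%:~R ^+ 2) `^ s * nc (c k) ^+ 2 <= B.

Lemma weight_ge1 (k : int) : 1 <= 1 + k%:~R ^+ 2 :> R.
Proof. by rewrite lerDl sqr_ge0. Qed.

Lemma sobolev_norm_ge0 s c : (0 <= sobolev_norm s c)%E.
Proof. exact: poweR_ge0. Qed.

Lemma sobolev_norm_bound s c (B : R) : 0 <= B ->
  (sobolev_norm s c <= B%:E)%E -> sobolev_bound s c (B ^+ 2).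
Proof.
move=> B0; rewrite /sobolev_norm; set S := esum _ _ => SB M.
have S0 : (0 <= S)%E.
  by apply: esum_ge0 => k _; rewrite lee_fin mulr_ge0 ?powR_ge0 ?sqr_ge0.
have S2 : (S <= (B ^+ 2)%:E)%E.
  have -> : S = ((S `^ 2^-1) `^ 2)%E by rewrite -poweRrM mulVf// poweRe1.
  rewrite -powR_mulrn// -poweR_EFin; apply: gt0_ler_poweR => //.
  - by rewrite in_itv/= poweR_ge0 leey.
  - by rewrite in_itv/= lee_fin B0 leey.
rewrite -lee_fin; apply: le_trans S2; apply: esum_ge.
exists [set` freqs M]; first by split => //; exact: finite_seq.
by rewrite -fsbig_seq ?freqs_uniq// sumEFin.
Qed.

Lemma sobolev_norm_lty_bound s c : (sobolev_norm s c < +oo)%E ->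
  exists B, sobolev_bound s c B.
Proof.
move=> cy; have c0 := sobolev_norm_ge0 s c.
exists (fine (sobolev_norm s c) ^+ 2); apply: sobolev_norm_bound.
  exact: fine_ge0.
by rewrite fineK// ge0_fin_numE.
Qed.

Lemma sobolev_bound_ge0 s c B : sobolev_bound s c B -> 0 <= B.
Proof.
move=> /(_ 0%N); apply: le_trans; apply: sumr_ge0 => k _.
by rewrite mulr_ge0 ?powR_ge0 ?sqr_ge0.
Qed.

Lemma sobolev_bound_coef s c B k : sobolev_bound s c B ->
  (1 + k%:~R ^+ 2) `^ s * nc (c k) ^+ 2 <= B.
Proof.
move=> /(_ `|k|%N); apply: le_trans.
pose F (k : int) := (1 + k%:~R ^+ 2) `^ s * nc (c k) ^+ 2 : R.
by apply: (@term_le_freqs _ F k) => j; rewrite mulr_ge0 ?powR_ge0 ?sqr_ge0.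
Qed.

(** Whatever the sign of [s], a limit in [H^s] is a limit of each coefficient; so the
    equation in [H^(mu - 3)] yields one differential equation per coefficient. *)
Lemma sobolev_norm_coef s k (eps : R) : 0 < eps -> exists2 delta : R, 0 < delta &
  forall c, (sobolev_norm s c <= delta%:E)%E -> nc (c k) <= eps.
Proof.
move=> e0; set w : R := (1 + k%:~R ^+ 2) `^ s.
have w0 : 0 < w by rewrite powR_gt0// (lt_le_trans ltr01)// weight_ge1.
exists (Num.sqrt w * eps); first by rewrite mulr_gt0// sqrtr_gt0.
move=> c cd; have /(sobolev_bound_coef k) := sobolev_norm_bound (mulr_ge0 (sqrtr_ge0 w) (ltW e0)) cd.
rewrite -/w exprMn (sqr_sqrtr (ltW w0)) ler_pM2l// ler_pXn2r// nnegrE ?nc_ge0//.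
exact: ltW.
Qed.

Lemma nc_Dx c k : nc (Dx c k) = `|k%:~R| * nc (c k).
Proof.
by rewrite /Dx ComplexField.Normc.normcM /= expr0n /= add0r sqrtr_sqr.
Qed.

Section AboveTwo.
Variables (mu : R) (mu2 : 2 <= mu).

Lemma weight_sqr_le (k : int) : (1 + k%:~R ^+ 2) ^+ 2 <= (1 + k%:~R ^+ 2) `^ mu :> R.
Proof.
rewrite -powR_mulrn ?(le_trans ler01) ?weight_ge1//.
by apply: ler_powR => //; exact: weight_ge1.
Qed.

(** With [v = 1 + k ^ 2], the arithmetic-geometric mean inequality bounds both
    [|c k|] and [|k| |c k|] by half of [1 / v + v ^ 2 |c k| ^ 2], and [1 / v] is summable. *)
Lemma sobolev_bound_l1 c B M : sobolev_bound mu c B ->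
  \sum_(k <- freqs M) nc (c k) <= (5 + B) / 2 /\
  \sum_(k <- freqs M) nc (Dx c k) <= (5 + B) / 2.
Proof.
move=> cB.
suff H (k : int) : nc (c k) <= ((1 + k%:~R ^+ 2)^-1 +
      (1 + k%:~R ^+ 2) `^ mu * nc (c k) ^+ 2) / 2 /\
    nc (Dx c k) <= ((1 + k%:~R ^+ 2)^-1 +
      (1 + k%:~R ^+ 2) `^ mu * nc (c k) ^+ 2) / 2.
  have S : \sum_(k <- freqs M) ((1 + k%:~R ^+ 2)^-1 +
      (1 + k%:~R ^+ 2) `^ mu * nc (c k) ^+ 2) / 2 <= (5 + B) / 2.
    rewrite -mulr_suml ler_pM2r// big_split /= lerD ?cB//.
    exact: sum_inv_sq_le.
  by split; apply: le_trans S; apply: ler_sum => k _; case: (H k).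
rewrite nc_Dx; set w : R := 1 + _; set n := nc _; set a : R := `|_|.
have w1 : 1 <= w by exact: weight_ge1.
have n0 : 0 <= n by exact: nc_ge0.
have a0 : 0 <= a by exact: normr_ge0.
have aw : w = 1 + a ^+ 2 by rewrite /w /a real_normK// num_real.
have wn : w ^+ 2 * n ^+ 2 <= w `^ mu * n ^+ 2.
  by rewrite ler_wpM2r ?sqr_ge0// weight_sqr_le.
have K : w * n <= (1 + w * (w ^+ 2 * n ^+ 2)) / 2.
  have -> : w * (w ^+ 2 * n ^+ 2) = (w * n) ^+ 2 * w by ring.
  have : (w * n) ^+ 2 <= (w * n) ^+ 2 * w by rewrite ler_peMr// sqr_ge0.
  have := sqr_ge0 (w * n - 1); lra.
have w0 : 0 < w by lra.
have K' : n <= (w^-1 + w ^+ 2 * n ^+ 2) / 2.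
  rewrite -(ler_pM2l w0); apply: le_trans K _.
  by rewrite [leRHS]mulrA mulrDr mulfV ?gt_eqF.
have K2 : a * n <= (w^-1 + w ^+ 2 * n ^+ 2) / 2.
  rewrite -(ler_pM2l w0).
  have -> : w * ((w^-1 + w ^+ 2 * n ^+ 2) / 2) = (1 + w ^+ 3 * n ^+ 2) / 2.
    by field; rewrite gt_eqF.
  have : a ^+ 2 * (w * n) ^+ 2 <= w * (w * n) ^+ 2.
    by rewrite ler_wpM2r ?sqr_ge0//; lra.
  have := sqr_ge0 (a * (w * n) - 1); lra.
by split; [apply: le_trans K' _|apply: le_trans K2 _]; rewrite ler_pM2r// lerD2l.
Qed.

Lemma sobolev_bound_l2 c B M : sobolev_bound mu c B ->
  \sum_(k <- freqs M) nc (c k) ^+ 2 <= B.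
Proof.
move=> /(_ M); apply: le_trans; apply: ler_sum => k _.
rewrite ler_peMl ?sqr_ge0//; apply: le_trans (weight_sqr_le k).
by rewrite exprn_ege1// weight_ge1.
Qed.

Definition low_pass N c : int -> R[i] := fun k => if `|k| <= N%:Z then c k else 0.
Definition high_pass N c : int -> R[i] := fun k => if `|k| <= N%:Z then 0 else c k.

(** The truncation error gains [N ^ (mu - 1)] for the derivative:
    on [|k| > N] one has [(1 + k ^ 2) N ^ (2 (mu - 1)) <= (1 + k ^ 2) ^ mu]. *)
Lemma high_pass_tail c B N M : (0 < N)%N -> sobolev_bound mu c B ->
  \sum_(k <- freqs M) (1 + k%:~R ^+ 2) * nc (high_pass N c k) ^+ 2 <=
  B / (N%:R `^ (mu - 1)) ^+ 2.
Proof.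
move=> N0 cB; have n0 : 0 < N%:R :> R by rewrite ltr0n.
rewrite ler_pdivlMr ?exprn_gt0 ?powR_gt0//.
apply: le_trans (cB M); rewrite mulr_suml; apply: ler_sum => k _.
rewrite /high_pass; case: ifPn => [_|kN].
  rewrite ComplexField.Normc.normc0 expr0n /= mulr0 mul0r.
  by rewrite mulr_ge0 ?powR_ge0 ?sqr_ge0.
rewrite mulrAC ler_wpM2r ?sqr_ge0//.
have w1 : 1 <= 1 + k%:~R ^+ 2 :> R by exact: weight_ge1.
have nk : N%:R ^+ 2 <= 1 + k%:~R ^+ 2 :> R.
  have : N%:R <= `|k%:~R| :> R.
    by rewrite -intr_norm pmulrn ler_int; lia.
  rewrite -(@ler_pXn2r _ 2%N)// ?nnegrE//.
  by rewrite real_normK ?num_real//; lra.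
have -> : (1 + k%:~R ^+ 2) `^ mu = (1 + k%:~R ^+ 2) * (1 + k%:~R ^+ 2) `^ (mu - 1) :> R.
  rewrite -[X in X * _]powRr1 ?(le_trans ler01)// -powRD; first by congr (_ `^ _); ring.
  by apply/implyP => _; rewrite gt_eqF// (lt_le_trans ltr01).
have w0 : 0 < 1 + k%:~R ^+ 2 :> R by lra.
rewrite (ler_pM2l w0).
rewrite -powR_mulrn ?powR_ge0// -powRrM mulrC powRrM (powR_mulrn 2 (ltW n0)).
have m0 : 0 <= mu - 1 by rewrite subr_ge0 (le_trans _ mu2)// ler1n.
by apply: (ge0_ler_powR m0) nk; rewrite nnegrE ?sqr_ge0// ltW.
Qed.

Lemma high_pass_l2 c B N M : (0 < N)%N -> sobolev_bound mu c B ->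
  \sum_(k <- freqs M) nc (high_pass N c k) ^+ 2 <= B / (N%:R `^ (mu - 1)) ^+ 2.
Proof.
move=> N0 /(high_pass_tail M N0); apply: le_trans; apply: ler_sum => k _.
by rewrite ler_peMl ?sqr_ge0// weight_ge1.
Qed.

Lemma high_pass_Dx_l2 c B N M : (0 < N)%N -> sobolev_bound mu c B ->
  \sum_(k <- freqs M) nc (Dx (high_pass N c) k) ^+ 2 <= B / (N%:R `^ (mu - 1)) ^+ 2.
Proof.
move=> N0 /(high_pass_tail M N0); apply: le_trans; apply: ler_sum => k _.
rewrite nc_Dx exprMn real_normK ?num_real// ler_wpM2r ?sqr_ge0//.
by rewrite lerDr.
Qed.

End AboveTwo.

Lemma sobolev_boundD s c d B B' : sobolev_bound s c B -> sobolev_bound s d B' ->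
  sobolev_bound s (fun k => c k + d k) (2 * (B + B')).
Proof.
move=> cB dB M; apply: (@le_trans _ _ (2 *
   (\sum_(k <- freqs M) (1 + k%:~R ^+ 2) `^ s * nc (c k) ^+ 2 +
    \sum_(k <- freqs M) (1 + k%:~R ^+ 2) `^ s * nc (d k) ^+ 2))); last first.
  by rewrite ler_pM2l// lerD.
rewrite -big_split mulr_sumr; apply: ler_sum => k _ /=.
rewrite -mulrDr [leRHS]mulrCA ler_wpM2l ?powR_ge0//.
apply: (@le_trans _ _ ((nc (c k) + nc (d k)) ^+ 2)).
  by rewrite ler_pXn2r ?nnegrE ?addr_ge0 ?nc_ge0// le_normcD.
by have := sqr_ge0 (nc (c k) - nc (d k)); lra.
Qed.

End SobolevBounds.

(** * Limits of extended-real norms *)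

Section ExtendedLimits.
Context {R : realType}.

Lemma cvge0_le {I : Type} (F : set_system I) {FF : Filter F} (f : I -> \bar R) :
  f @ F --> 0%E -> forall eps : R, 0 < eps -> \forall x \near F, (f x <= eps%:E)%E.
Proof.
move=> /fine_cvgP[ffin /cvgr0_norm_le ff] eps e0.
have := ff _ e0; move: ffin; apply: filterS2 => x fx /= h.
by rewrite -(fineK fx) lee_fin (le_trans (ler_norm _)).
Qed.

(** Near [t] the norm of [c t'] exceeds that of [c t] by a bounded amount;
    compactness makes this local bound uniform. *)
Lemma sobolev_continuous_bounded (s T : R) (c : R -> int -> R[i]) :
  sobolev_continuous s T c ->
  (forall t, t \in `[0, T] -> exists B, sobolev_bound s (c t) B) ->
  exists B, forall t, t \in `[0, T] -> sobolev_bound s (c t) B.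
Proof.
move=> cc cb.
have cpt : compact `[0, T]%classic by exact: segment_compact.
have /near_covering_withinP/(_ R (pinfty_nbhs R) (fun B t => sobolev_bound s (c t) B)) :
  near_covering `[0, T]%classic by apply/compact_near_coveringP.
move=> /(_ _)[].
- move=> t tT; have [B cB] := cb t tT.
  have /cvge0_le/(_ 1 ltr01) := cc t tT.
  move=> near1; exists ([set t' | `[0, T]%classic t' ->
      (sobolev_norm s (fun k => c t' k - c t k)%R <= 1)%E],
    [set B' | 2 * (1 ^+ 2 + B) <= B']).
    split; first exact: near1.
    by apply: nbhs_pinfty_ge; rewrite num_real.
  move=> [t' B'] /= [t'1 BB'] /t'1 {}t'1 M; apply: le_trans BB'.
  have := sobolev_boundD (sobolev_norm_bound ler01 t'1) cB => /(_ M).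
  congr (_ <= _); apply: eq_bigr => k _; by rewrite subrK.
- move=> B [_ h]; exists (B + 1) => t tT; apply: (h (B + 1)) => //.
  by rewrite ltrDl.
Qed.

End ExtendedLimits.

(** * The energy inequality *)

Section EnergyRate.
Context {R : realType}.
Implicit Types (a b c e y z : int -> R[i]).

Lemma trilinear_expand N M L e y z : (N + M <= L)%N ->
  (forall k, N%:Z < `|k| -> e k = 0) -> (forall k, M%:Z < `|k| -> y k = 0) ->
  trilinear L e y z =
  \sum_(k <- freqs N) e (- k) * \sum_(j <- freqs M) y j * z (k - j).
Proof.
move=> NML e0 y0; rewrite /trilinear.
rewrite (sum_freqs_widen (N := N)) ?(leq_trans (leq_addr _ _) NML)//; last first.
  move=> k /e0 ek; rewrite big1// => j _; rewrite big1// => l _.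
  by rewrite ek !mul0r mulr0.
rewrite -sum_freqsN big_seq [RHS]big_seq; apply: eq_bigr => k; rewrite mem_freqs => kN.
rewrite (sum_freqs_widen (N := M)) ?(leq_trans (leq_addl _ _) NML)//; last first.
  move=> j /y0 yj; rewrite big1// => l _.
  by rewrite yj mulr0 mul0r mulr0.
rewrite mulr_sumr big_seq [RHS]big_seq; apply: eq_bigr => j; rewrite mem_freqs => jM.
rewrite (sum_freqs_delta (k := k - j)).
- by rewrite (_ : - k + j + (k - j) = 0) ?eqxx ?mul1r ?mulrA//; ring.
- by rewrite mem_freqs; lia.
- move=> l lkj; case: eqP => [kjl|]; last by rewrite mul0r.
  by move: lkj; rewrite (_ : l = k - j) ?eqxx//; lia.
Qed.

Lemma Dx_conj c : (forall k, c (- k) = conjc (c k)) ->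
  forall k, Dx c (- k) = conjc (Dx c k).
Proof.
move=> cN k; rewrite /Dx cN (rmorphM (@conjc R)); congr (_ * _).
by apply/eqP; rewrite eq_complex /= rmorphN/= ?oppr0 !eqxx.
Qed.

(** The dispersive term is skew-adjoint, so it does not change the energy. *)
Lemma Re_conj_Dx3 c k : complex.Re (conjc (c k) * iter 3 Dx c k) = 0.
Proof.
by rewrite /= /Dx; case: (c k) => x y /=; ring.
Qed.

Lemma iter_Dx3B a b k : iter 3 Dx b k - iter 3 Dx a k = iter 3 Dx (fun k => b k - a k) k.
Proof. by rewrite /= /Dx; ring. Qed.

(** Only window sums of the convolution [u u_x] are at hand, converging to [F]; but
    [flux_bound] is uniform in the window, so the inequality passes to the limit. *)
Lemma energy_rate N a b (F d : int -> R[i]) (A eta : R) (tail : nat -> R) :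
  (forall k, a (- k) = conjc (a k)) -> (forall k, b (- k) = conjc (b k)) ->
  (forall k, N%:Z < `|k| -> b k = 0) ->
  (forall M, \sum_(k <- freqs M) nc (a k) <= A) ->
  (forall M, \sum_(k <- freqs M) nc (Dx a k) <= A) ->
  (forall M, \sum_(k <- freqs M) nc (high_pass N a k) ^+ 2 <= eta) ->
  (forall M, \sum_(k <- freqs M) nc (Dx (high_pass N a) k) ^+ 2 <= eta) ->
  tail @ \oo --> (0 : R) ->
  (forall M k, nc (F k - \sum_(j <- freqs M) a j * Dx a (k - j)) <= tail M) ->
  (forall k, k \in freqs N -> d k =
     - (\sum_(j <- freqs N) b j * Dx b (k - j) - F k) -
     (iter 3 Dx b k - iter 3 Dx a k)) ->
  \sum_(k <- freqs N) (2 * complex.Re (conjc (b k - a k) * d k)) <=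
  3 * A * (\sum_(k <- freqs N) nc (b k - a k) ^+ 2 + eta).
Proof.
move=> aN bN b0 aA DaA ra rDa tail0 Ft dE.
pose e := low_pass N (fun k => b k - a k); pose w := low_pass N a.
have eN k : e (- k) = conjc (e k).
  rewrite /e /low_pass normrN; case: ifP => _; last by rewrite conjc0.
  by rewrite aN bN (rmorphB (@conjc R)).
have e0 k : N%:Z < `|k| -> e k = 0 by rewrite /e /low_pass ltNge => /negbTE->.
have eE k : k \in freqs N -> e k = b k - a k.
  by rewrite mem_freqs /e /low_pass => ->.
have ewb : b = fun k => e k + w k.
  apply/funext => k; rewrite /e /w /low_pass; case: ifPn => [_|kN].
    by rewrite subrK.
  by rewrite b0 ?addr0// ltNge.
pose r := high_pass N a.
have ar : a = fun k => w k + r k.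
  by apply/funext => k; rewrite /w /r /low_pass /high_pass; case: ifP => _;
    rewrite ?addr0 ?add0r.
have EE : \sum_(k <- freqs N) nc (b k - a k) ^+ 2 = \sum_(k <- freqs N) nc (e k) ^+ 2.
  by rewrite big_seq [RHS]big_seq; apply: eq_bigr => k kN; rewrite eE.
rewrite EE -mulr_sumr -subr_le0.
pose Se := \sum_(k <- freqs N) nc (e k).
have tail0' : (fun M => 2 * (Se * tail (M + N)%N)) @ \oo --> (0 : R).
  rewrite -[X in _ --> X](mulr0 2); apply: cvgM; first exact: cvg_cst.
  rewrite -[X in _ --> X](mulr0 Se); apply: cvgM; first exact: cvg_cst.
  by rewrite (cvg_shiftn N tail).
apply: (le0_cvg0 tail0') => n; set M := (n + N)%N.
pose r1 := high_pass N (low_pass M a); pose L := (N + M)%N.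
have wr1 : low_pass M a = fun k => w k + r1 k.
  apply/funext => k; rewrite /w /r1 /high_pass /low_pass.
  case: (ifP (`|k| <= N%:Z)) => kN; last by rewrite add0r.
  by rewrite addr0 ifT//; move: kN; rewrite /M; lia.
have lpE c (M' : nat) k : nc (low_pass M' c k) <= nc (c k).
  by rewrite /low_pass; case: ifP => //; rewrite ComplexField.Normc.normc0 nc_ge0.
have flux := @flux_bound R L e w r1 r A A eta.
have {}flux : nc (trilinear L e b (Dx b) - trilinear L e (low_pass M a) (Dx a)) <=
    (A / 2 + A) * (\sum_(k <- freqs L) nc (e k) ^+ 2 + eta).
  rewrite ewb {2}ar wr1; apply: flux.
  - apply: le_trans (aA L); apply: ler_sum => k _.
    have -> : w k + r1 k = low_pass M a k by rewrite wr1.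
    exact: lpE.
  - apply: le_trans (DaA L); apply: ler_sum => k _; rewrite !nc_Dx.
    by rewrite ler_wpM2l// lpE.
  - apply: le_trans (ra L); apply: ler_sum => k _.
    rewrite ler_pXn2r ?nnegrE ?nc_ge0// /r1 /high_pass; by case: ifP.
  - exact: rDa.
rewrite (sum_freqs_widen (N := N)) ?leq_addr// in flux; last first.
  by move=> k /e0->; rewrite ComplexField.Normc.normc0 expr0n.
rewrite (trilinear_expand (N := N) (M := N)) ?leq_add2l ?leq_addl// in flux.
rewrite (trilinear_expand (N := N) (M := M)) ?leqnn// in flux; last first.
  by move=> k; rewrite ltNge /low_pass => /negbTE->.
have low j : j \in freqs M -> low_pass M a j = a j.
  by rewrite mem_freqs /low_pass => ->.
move: flux; under [X in _ - X]eq_bigr do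
  (under eq_big_seq => j jM do rewrite low//).
set Tb := \sum_(k <- freqs N) _; set Ta := \sum_(k <- freqs N) _ => flux.
pose TF := \sum_(k <- freqs N) e (- k) * F k.
have S : \sum_(k <- freqs N) complex.Re (conjc (b k - a k) * d k) = - complex.Re (Tb - TF).
  rewrite -[RHS](raddfN (@complex.Re R)) /Tb /TF -sumrB -sumrN (raddf_sum (@complex.Re R)).
  rewrite big_seq [RHS]big_seq; apply: eq_bigr => k kN.
  rewrite dE// iter_Dx3B mulrBr ReB (Re_conj_Dx3 (fun k => b k - a k)) subr0.
  by rewrite eN eE// mulrN mulrBr.
have TFa : nc (TF - Ta) <= Se * tail M.
  rewrite /TF /Ta -sumrB; apply: le_trans (nc_sum _ _) _.
  rewrite /Se mulr_suml; apply: ler_sum => k _.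
  by rewrite -mulrBr ComplexField.Normc.normcM eN nc_conj ler_wpM2l ?nc_ge0.
have := le_trans (ler_norm _) (nc_Re (Ta - Tb)); rewrite nc_sub ReB.
have := le_trans (ler_norm _) (nc_Re (TF - Ta)); rewrite !ReB S ReB.
set E := \sum_(k <- _) nc (e k) ^+ 2 in flux *.
lra.
Qed.

End EnergyRate.

(** * A Gronwall inequality *)

Section Gronwall.
Context {R : realType}.
Implicit Types (E dE : R -> R).

Lemma gronwall (T K eta : R) E dE : 0 <= eta -> 0 <= K -> E 0 = 0 ->
  {within `[0, T], continuous E} ->
  (forall t : R, t \in `]0, T[ -> is_derive t 1 E (dE t)) ->
  (forall t : R, t \in `]0, T[ -> dE t <= K * (E t + eta)) ->
  forall t, t \in `[0, T] -> E t + eta <= eta * expR (K * T).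
Proof.
move=> eta0 K0 E0 cE DE dEK t; rewrite in_itv/= => /andP[t0 tT].
have ex1 : 1 <= expR (K * T).
  by rewrite -expR0 ler_expR mulr_ge0// (le_trans t0).
move: t0; rewrite le_eqVlt => /predU1P[<-|t0].
  by rewrite E0 add0r ler_peMr.
(* The hypothesis on [dE] says that [G] does not increase. *)
pose G s := (E s + eta) * expR (- K * s).
have DG s : s \in `]0, t[ ->
    is_derive s 1 G ((dE s - K * (E s + eta)) * expR (- K * s)).
  rewrite in_itv/= => /andP[s0 st].
  have sT : s \in `]0, T[ by rewrite in_itv/= s0 (lt_le_trans st).
  have D1 := is_deriveD (DE s sT) (is_derive_cst eta s 1).
  have D2 := is_derive1_comp (is_derive_expR (- K * s)) (is_derive_mull (- K) s).
  apply: (is_derive_eq (is_deriveM D1 D2)).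
  rewrite /GRing.scale /= fctE /cst; ring.
have cG : {within `[0, t], continuous G}.
  have cE' : {within `[0, t], continuous E}.
    apply: continuous_subspaceW cE => s /=; rewrite !in_itv/= => /andP[-> st].
    exact: le_trans st tT.
  move=> x; apply: cvgM.
    by apply: cvgD; [exact: cE'|exact: cvg_cst].
  apply: (@continuous_subspaceT _ _ _ (fun s => expR (- K * s))) => {}x.
  apply: (@continuous_comp _ _ _ (fun s => - K * s) expR); last exact: continuous_expR.
  exact: mulrl_continuous.
have [c + Gtc] := MVT t0 DG cG.
rewrite in_itv/= => /andP[c0 ct].
have Gle : G t <= G 0.
  rewrite -subr_le0 Gtc subr0 mulr_le0_ge0 ?(ltW t0)// mulr_le0_ge0 ?expR_ge0//.
  by rewrite subr_le0; apply: dEK; rewrite in_itv/= c0 (lt_le_trans ct).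
have -> : E t + eta = G t * expR (K * t).
  by rewrite /G -mulrA -expRD mulNr addNr expR0 mulr1.
apply: (@le_trans _ _ (eta * expR (K * t))).
  rewrite ler_wpM2r ?expR_ge0// (le_trans Gle)//.
  by rewrite /G E0 add0r mulr0 expR0 mulr1.
by rewrite ler_wpM2l// ler_expR ler_wpM2l.
Qed.

End Gronwall.

(** * Time derivatives of Fourier coefficients *)

Section CoefDerivative.
Context {R : realType}.
Implicit Types (p q : R -> R[i]) (T t : R).

(** The derivative of one Fourier coefficient, one-sided at the end points of [[0, T]].
    It is stated with the modulus because both the mean-square and the Sobolev
    difference quotients give bounds on moduli. *)
Definition coef_derivative T p t (d : R[i]) : Prop :=
  forall eps : R, 0 < eps -> \forall tau \near within `[0, T] t^',
    nc (((tau - t)^-1)%:C * (p tau - p t) - d) <= eps.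

Lemma near_within_dnbhs T t (P : R -> Prop) : t \in `]0, T[ ->
  (\forall tau \near within `[0, T] t^', P tau) -> \forall tau \near t^', P tau.
Proof.
move=> tT; rewrite near_withinE; apply: filter_app; apply: nbhs_dnbhs.
by near=> s => /(_ _); apply; apply: subset_itv_oo_cc; near: s; exact: near_in_itvoo.
Unshelve. all: by end_near. Qed.

Lemma is_derive_quotient (f : R -> R) t (d : R) :
  (forall eps : R, 0 < eps ->
    \forall tau \near t^', `|(tau - t)^-1 * (f tau - f t) - d| <= eps) ->
  is_derive t 1 f d.
Proof.
move=> H.
have cv : (fun h : R => h^-1 *: ((f \o shift t) (h *: (1 : R)) - f t)) @ 0^' --> d.
  apply/cvgrPdist_le => eps /H; rewrite !near_withinE => /nbhs_ballP[e e0 he].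
  apply/nbhs_ballP; exists e => // h; rewrite /ball /= sub0r normrN => hh h0.
  have := he (h + t); rewrite /ball /= opprD addrA.
  rewrite (_ : t - h - t = - h) ?normrN; last by ring.
  move=> /(_ hh); rewrite addrK distrC /GRing.scale/= mulr1; apply.
  by apply: contra_neq h0 => ht; apply: (addIr t); rewrite ht add0r.
apply: DeriveDef; first by apply/cvg_ex; exists d.
by apply/cvg_lim; [exact: Rhausdorff|exact: cv].
Qed.

Lemma coef_derivativeB T p q t d d' : coef_derivative T p t d ->
  coef_derivative T q t d' -> coef_derivative T (fun s => p s - q s) t (d - d').
Proof.
move=> pd qd eps e0; have e2 : 0 < eps / 2 by rewrite divr_gt0.
have := qd _ e2; have := pd _ e2; apply: filterS2 => s ps qs.
set h := _%:C in ps qs *.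
have -> : h * (p s - q s - (p t - q t)) - (d - d') =
  (h * (p s - p t) - d) - (h * (q s - q t) - d') by ring.
apply: le_trans (le_normcD _ _) _; rewrite normcN.
by apply: le_trans (lerD ps qs) _; rewrite -splitr.
Qed.

Lemma coef_derivative_is_derive T p t d : t \in `]0, T[ -> coef_derivative T p t d ->
  is_derive t 1 (fun s => nc (p s) ^+ 2) (2 * complex.Re (conjc (p t) * d)).
Proof.
move=> tT pd.
have DRe : is_derive t 1 (fun s => complex.Re (p s)) (complex.Re d).
  apply: is_derive_quotient => eps /pd /(near_within_dnbhs tT).
  apply: filterS => s; apply: le_trans; apply: le_trans (nc_Re _).
  by rewrite !ReB Re_realM ReB.
have DIm : is_derive t 1 (fun s => complex.Im (p s)) (complex.Im d).
  apply: is_derive_quotient => eps /pd /(near_within_dnbhs tT).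
  apply: filterS => s; apply: le_trans; apply: le_trans (nc_Im _).
  by rewrite !ImB Im_realM ImB.
have := is_deriveD (is_deriveM DRe DRe) (is_deriveM DIm DIm).
have -> : (fun s => complex.Re (p s)) * (fun s => complex.Re (p s)) +
    (fun s => complex.Im (p s)) * (fun s => complex.Im (p s)) =
    (fun s => nc (p s) ^+ 2) :> (R -> R).
  by apply/funext => s; rewrite nc_sqr !expr2.
move=> D; apply: (is_derive_eq D); rewrite /GRing.scale /=.
by case: (p t) d {pd DRe DIm D} => x y [x' y'] /=; ring.
Qed.

Lemma coef_derivative_cvg T p t d : coef_derivative T p t d ->
  forall eps : R, 0 < eps ->
  \forall s \near within `[0, T] (nbhs t), nc (p s - p t) <= eps.
Proof.
move=> /(_ 1 ltr01); rewrite !near_withinE => pd eps e0.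
have c0 : 0 < 1 + nc d by rewrite ltr_pwDl// nc_ge0.
have : \forall s \near t, `|t - s| <= eps / (1 + nc d).
  apply/nbhs_ballP; exists (eps / (1 + nc d)); first by rewrite /= divr_gt0.
  by move=> s; rewrite /ball /= => /ltW.
rewrite near_withinE; move: pd; apply: filterS2 => s ps ts sT.
have [->|st] := eqVneq s t; first by rewrite subrr ComplexField.Normc.normc0 ltW.
have := ps st sT; set h := _%:C => hq.
have st0 : s - t != 0 by rewrite subr_eq0.
have -> : p s - p t = (s - t)%:C * (h * (p s - p t)).
  by rewrite mulrA /h -rmorphM /= mulfV// mul1r.
rewrite ComplexField.Normc.normcM nc_real distrC.
apply: (@le_trans _ _ (eps / (1 + nc d) * (1 + nc d))); last by rewrite divfK// gt_eqF.
apply: ler_pM => //; first exact: nc_ge0.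
rewrite -[X in nc X](subrK d); apply: le_trans (le_normcD _ _) _.
by rewrite lerD2r.
Qed.

End CoefDerivative.

(** * The Galerkin system in coefficients *)

Section TrigPoly.
Context {R : realType}.
Implicit Types (c : int -> R[i]) (f : R -> R) (N : nat).

Lemma trig_poly_fourier N (v : R -> R[i]) : trig_poly N v ->
  v = trig_sum N (fourier v) /\ forall k, N%:Z < `|k| -> fourier v k = 0.
Proof.
move=> [c _ <-]; split; last by move=> k; rewrite fourier_trig_sum ltNge => /negbTE->.
apply/funext => x; rewrite /trig_sum; apply: eq_big_seq => k.
by rewrite mem_freqs fourier_trig_sum => ->.
Qed.

Lemma trig_poly_continuous N f : trig_poly N (toC f) -> continuous f.
Proof.
move=> [c _ cf]; have -> : f = fun x => complex.Re (trig_sum N c x).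
  by apply/funext => x; rewrite cf.
exact: continuous_Re_trig_sum.
Qed.

Lemma is_derive_Re_trig_sum N c (x : R) :
  is_derive x 1 (fun y : R => complex.Re (trig_sum N c y)) (complex.Re (trig_sum N (Dx c) x)).
Proof.
rewrite /trig_sum; elim: (freqs N) => [|k s IH].
  rewrite big_nil; under eq_fun do rewrite big_nil.
  exact: is_derive_cst.
rewrite big_cons; under eq_fun do rewrite big_cons.
have DD : is_derive x 1 (fun y : R => complex.Re (c k * expi k y)) (complex.Re (Dx c k * expi k x)).
  have := is_deriveB (is_deriveZ (complex.Re (c k)) (is_derive_cosM k%:~R x))
     (is_deriveZ (complex.Im (c k)) (is_derive_sinM k%:~R x)).
  have -> : (complex.Re (c k) \*: (fun y : R => cos (k%:~R * y))) -
     (complex.Im (c k) \*: (fun y : R => sin (k%:~R * y))) =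
     (fun y => complex.Re (c k * expi k y)) :> (R -> R).
    by apply/funext => y; rewrite /expi; case: (c k).
  move=> D; apply: (is_derive_eq D); rewrite /Dx /expi /GRing.scale /=.
  by case: (c k) => a b /=; ring.
have := is_deriveD DD IH.
have -> : (fun y => complex.Re (c k * expi k y)) +
   (fun y => complex.Re (\sum_(j <- s) c j * expi j y)) =
   (fun y => complex.Re (c k * expi k y + \sum_(j <- s) c j * expi j y)) :> (R -> R).
  by apply/funext => y; rewrite fctE ReD.
move=> D; apply: (is_derive_eq D).
by rewrite ReD.
Qed.

Lemma toC_derive1 N c f : toC f = trig_sum N c -> (forall k, c (- k) = conjc (c k)) ->
  toC (f^`()%classic) = trig_sum N (Dx c).
Proof.
move=> cf cN; apply/funext => x.
rewrite -(conj_eq_real (conj_trig_sum N x (Dx_conj cN))) /toC; congr (_%:C).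
have -> : f = fun y => complex.Re (trig_sum N c y) by apply/funext => y; rewrite -cf.
by rewrite derive1E; have D := is_derive_Re_trig_sum N c x; exact: derive_val.
Qed.

Lemma toC_derive3 N c f : toC f = trig_sum N c -> (forall k, c (- k) = conjc (c k)) ->
  toC (f^`(3)%classic) = trig_sum N (iter 3 Dx c).
Proof.
move=> cf cN; rewrite !derive1nS derive1n0 /=.
have D1 := toC_derive1 cf cN; have c1 := Dx_conj cN.
have D2 := toC_derive1 D1 c1; have c2 := Dx_conj c1.
exact: toC_derive1 D2 c2.
Qed.

(** The constant is crude, from [|f| <= (delta + f ^ 2 / delta) / 2]. *)
Lemma nc_fourier_L2 f k (delta : R) : 0 < delta -> L2 f -> (L2norm f <= delta%:E)%E ->
  nc (fourier (toC f) k) <= 2 * delta.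
Proof.
move=> d0 Lf; have /L2P[mf If2] := Lf; have If := L2_integrable Lf.
rewrite L2normE// lee_fin => fd.
set I := \int[_]_(_ in _) _ in fd.
have I0 : 0 <= I by apply: Rintegral_ge0 => x _; exact: sqr_ge0.
have Id : I <= delta ^+ 2.
  rewrite -(sqr_sqrtr I0) ler_pXn2r ?nnegrE ?sqrtr_ge0//; exact: ltW.
apply: le_trans (nc_fourier_le k If) _; rewrite -mulrA ler_pM2l//.
rewrite mulrC ler_pdivrMr ?pi2_gt0//.
have Ic : circle_integrable (fun=> delta / 2 : R).
  by apply: continuous_circle_integrable => x; exact: cvg_cst.
have Iq := circle_integrableZ ((2 * delta)^-1) If2.
apply: (@le_trans _ _ (\int[lebesgue_measure]_(x in circle R) (delta / 2 + (2 * delta)^-1 * f x ^+ 2))).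
  apply: le_Rintegral; first exact: measurable_circle.
  - exact: circle_integrable_norm.
  - exact: circle_integrableD.
  - move=> x _; rewrite -(ler_pM2l (mulr_gt0 (ltr0Sn R 1) d0)) mulrDr mulrA.
    rewrite [X in _ + X](mulrA _ _^-1) mulfV ?mul1r; last by rewrite mulf_neq0// gt_eqF.
    rewrite -[X in X ^+ 2](mul1r) -real_normK ?num_real// mul1r.
    by have := sqr_ge0 (`|f x| - delta); lra.
rewrite RintegralD//; [|exact: measurable_circle].
rewrite circle_integral_cst RintegralZl//; last exact: measurable_circle.
rewrite -/I; have : (2 * delta)^-1 * I <= delta / 2.
  rewrite -(ler_pM2l (mulr_gt0 (ltr0Sn R 1) d0)) mulrA mulfV ?mul1r; last first.
    by rewrite mulf_neq0// gt_eqF.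
  by rewrite (_ : 2 * delta * (delta / 2) = delta ^+ 2)//; field.
have p2 := pi_ge2 R; rewrite (mulr2n pi) => h; have : delta * 2 <= delta * pi by rewrite ler_pM2l.
have -> : delta / 2 * (pi + pi) = delta * pi by field.
lra.
Qed.

End TrigPoly.

Section GalerkinSystem.
Context {R : realType}.
Variables (T : R) (u0 : R -> R) (N : nat) (uN : R -> R -> R).
Hypothesis gal : galerkin T u0 N uN.
Let b t := fourier (toC (uN t)).

Lemma galerkin_continuous t : t \in `[0, T] -> continuous (uN t).
Proof. by move=> /(galerkin_space gal)/trig_poly_continuous. Qed.

Lemma galerkin_L2 t : t \in `[0, T] -> L2 (uN t).
Proof. by move=> /galerkin_continuous/continuous_L2. Qed.

Lemma galerkin_coef_conj t : t \in `[0, T] -> forall k, b t (- k) = conjc (b t k).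
Proof.
by move=> /galerkin_continuous/continuous_circle_integrable Ib k; exact: fourier_conj.
Qed.

Lemma galerkin_coef0 t : t \in `[0, T] -> forall k, N%:Z < `|k| -> b t k = 0.
Proof. by move=> /(galerkin_space gal)/trig_poly_fourier[]. Qed.

Lemma galerkin_coef_initial k : `|k| <= N%:Z -> b 0 k = fourier (toC u0) k.
Proof.
by move=> kN; rewrite /b (galerkin_initial gal) /fourier_proj fourier_trig_sum kN.
Qed.

(** Testing the Galerkin equation with [chi = expi k] selects its [k]-th coefficient. *)
Lemma galerkin_ode t : t \in `[0, T] -> exists2 n : int -> R[i],
  (forall k, coef_derivative T (fun s => b s k) t (n k)) &
  forall k, k \in freqs N ->
    n k = - (\sum_(j <- freqs N) b t j * Dx (b t) (k - j)) - iter 3 Dx (b t) k.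
Proof.
move=> tT; have [ut [utP utD utE]] := galerkin_equation gal tT.
exists (fourier (toC ut)).
  move=> k eps e0; have e2 : 0 < eps / 2 by rewrite divr_gt0.
  have /cvge0_le/(_ _ e2) := utD; rewrite !near_withinE; apply: filterS => s sh st sT.
  have Ls := galerkin_L2 sT; have Lt := galerkin_L2 tT.
  have Lut := continuous_L2 (trig_poly_continuous utP).
  have Lq := L2Z (s - t)^-1 (L2B Ls Lt).
  have := nc_fourier_L2 k e2 (L2B Lq Lut) (sh st sT).
  rewrite fourier_toCB ?fourier_toCZ ?fourier_toCB; try exact: L2_integrable.
    by rewrite (mulrC 2) divfK.
  exact/L2_integrable/L2B.
move=> k kN; have [bE _] := trig_poly_fourier (galerkin_space gal tT).
have bN := galerkin_coef_conj tT.
have D1 := toC_derive1 bE bN; have D3 := toC_derive3 bE bN.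
have kP : trig_poly N (expi k : R -> R[i]).
  exists (fun j => (j == k)%:R) => //; apply/funext => x.
  rewrite /trig_sum (sum_freqs_delta kN) ?eqxx ?mul1r// => j /negbTE->.
  by rewrite mul0r.
have := utE _ kP; rewrite /inner.
have -> : (fun x => toC (fun x => ut x + uN t x * (uN t)^`()%classic x +
     (uN t)^`(3)%classic x) x * (expi k x)^*%R) =
   (fun x => expi (- k) x * ((toC ut x + trig_sum N (b t) x * trig_sum N (Dx (b t)) x) +
      trig_sum N (iter 3 Dx (b t)) x)).
  apply/funext => x; rewrite -D1 -D3 -bE mulrC expiN; congr (_ * _).
  by rewrite /toC !rmorphD rmorphM.
move=> h; have : fourier (fun x => (toC ut x + trig_sum N (b t) x * trig_sum N (Dx (b t)) x) +
      trig_sum N (iter 3 Dx (b t)) x) k = 0 by rewrite /fourier h mulr0.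
have Iut : cintegrable (toC ut).
  exact/cintegrable_toC/continuous_circle_integrable/(trig_poly_continuous utP).
have IM : cintegrable (fun x => trig_sum N (b t) x * trig_sum N (Dx (b t)) x).
  rewrite (_ : (fun x => _) = fun x => \sum_(j <- freqs N) b t j *
     (expi j x * trig_sum N (Dx (b t)) x)).
    apply: cintegrable_sum => j; apply/cintegrableZ/cintegrable_expiM.
    exact: cintegrable_trig_sum.
  apply/funext => x; rewrite {1}/trig_sum mulr_suml.
  by apply: eq_bigr => j _; rewrite mulrA.
rewrite fourierD; [|exact: cintegrableD|exact: cintegrable_trig_sum].
rewrite fourierD// fourier_trig_sumM; last exact: cintegrable_trig_sum.
rewrite fourier_trig_sum ifT -?mem_freqs// => /eqP.
rewrite -addrA addr_eq0 opprD => /eqP ->; congr (- _ - _).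
apply: eq_bigr => j _; rewrite fourier_trig_sum; case: ifPn => // kj.
have b0 : b t (k - j) = 0 by apply: galerkin_coef0 => //; rewrite ltNge.
by rewrite /Dx b0 !mulr0.
Qed.

End GalerkinSystem.

Section KdvSystem.
Context {R : realType}.
Variables (T mu : R) (u0 : R -> R) (u : R -> R -> R).
Hypothesis solu : kdv_solution T mu u0 u.
Hypothesis mu2 : 2 <= mu.
Let a t := fourier (toC (u t)).

Lemma kdv_L2 t : t \in `[0, T] -> L2 (u t).
Proof. by move=> /(kdv_sobolev solu)[]. Qed.

Lemma kdv_coef_conj t : t \in `[0, T] -> forall k, a t (- k) = conjc (a t k).
Proof. by move=> /kdv_L2/L2_integrable Iu k; exact: fourier_conj. Qed.

Lemma kdv_bounded : exists B, forall t, t \in `[0, T] -> sobolev_bound mu (a t) B.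
Proof.
apply: (sobolev_continuous_bounded (kdv_continuous solu)) => t tT.
by have [_ _ /sobolev_norm_lty_bound] := kdv_sobolev solu tT.
Qed.

Lemma kdv_coef_initial k : 0 <= T -> fourier (toC u0) k = a 0 k.
Proof.
move=> T0; have T00 : 0 \in `[0, T] by rewrite in_itv/= lexx.
rewrite /a; symmetry; apply: ae_eq_fourier.
- exact: L2_circle_measurable (kdv_L2 T00).
- by have [_ /L2_integrable] := kdv_data solu.
- by apply: ae_sub (kdv_initial solu) => x.
Qed.

(** [F] collects the coefficients of [u u_x]; by [fourier_mul_cvg] they are limits of
    convolutions, with an error [tail] that does not depend on the frequency. *)
Lemma kdv_ode t : t \in `[0, T] -> exists d F : int -> R[i], exists tail : nat -> R,
  [/\ forall k, coef_derivative T (fun s => a s k) t (d k),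
    tail @ \oo --> (0 : R),
    forall M k, nc (F k - \sum_(j <- freqs M) a t j * Dx (a t) (k - j)) <= tail M &
    forall k, d k = - F k - iter 3 Dx (a t) k].
Proof.
move=> tT; have [ux [ut [[_ Lux] uxE _ utD utE]]] := kdv_equation solu tT.
have [B aB] := kdv_bounded.
have aA M := (sobolev_bound_l1 mu2 M (aB t tT)).1.
have [_ [tail tail0 Ft]] := fourier_mul_cvg (L2_integrable (kdv_L2 tT)) (L2_integrable Lux) aA.
exists ut, (fourier (toC (fun x => u t x * ux x))), tail; split => //.
- move=> k eps e0; have [delta d0 dk] := sobolev_norm_coef (mu - 3) k e0.
  have /cvge0_le/(_ _ d0) := utD; apply: filterS => s /dk; exact.
- by move=> M k; have := Ft M k; rewrite uxE.
- by move=> k; have /eqP := utE k; rewrite -addrA addr_eq0 opprD => /eqP.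
Qed.

End KdvSystem.

(** * The error in the mean-square norm *)

Section L2Norm.
Context {R : realType}.
Notation mu := (@lebesgue_measure R).
Implicit Types (f g : R -> R).

Lemma L2normD f g : L2 f -> L2 g ->
  (L2norm (fun x => f x + g x)%R <= L2norm f + L2norm g)%E.
Proof.
move=> /L2_circle_measurable mf /L2_circle_measurable mg.
have mf' := (measurable_restrictT f (@measurable_circle R)).1 mf.
have mg' := (measurable_restrictT g (@measurable_circle R)).1 mg.
have := @minkowski_EFin _ _ _ mu _ _ 2 mf' mg' (ler1n _ 2).
congr (_ <= _)%E; rewrite /L2norm; congr (Lnorm _ _ _); apply/funext => x /=.
by rewrite !patchE; case: ifP => //= _; rewrite addr0.
Qed.

Lemma L2norm_fin f : L2 f -> exists2 r : R, 0 <= r & L2norm f = r%:E.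
Proof.
move=> /L2P[mf If]; exists (Num.sqrt (\int[mu]_(x in circle R) (f x ^+ 2))).
  exact: sqrtr_ge0.
exact: L2normE.
Qed.

Lemma L2norm_le f (A S : R) : L2 f ->
  (forall M, \sum_(k <- freqs M) nc (fourier (toC f) k) <= A) ->
  (forall M, \sum_(k <- freqs M) nc (fourier (toC f) k) ^+ 2 <= S) ->
  (L2norm f <= (Num.sqrt (pi *+ 2 * S))%:E)%E.
Proof.
move=> Lf fA fS; have /L2P[mf If] := Lf.
have [_ Ile] := parseval_le (L2_integrable Lf) fA fS.
by rewrite L2normE// lee_fin ler_wsqrtr.
Qed.

Lemma L2norm_subC f g : L2norm (fun x => f x - g x) = L2norm (fun x => g x - f x).
Proof.
rewrite /L2norm -oppe_Lnorm; congr (Lnorm _ _ _); apply/funext => x /=.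
by rewrite !patchE; case: ifP => _ /=; rewrite ?opprB// oppr0.
Qed.

End L2Norm.

Section WindowLimits.
Context {R : realType}.

Lemma cvg_sum_nc_sqr {I : Type} (F : set_system I) {FF : Filter F} N
    (p : I -> int -> R[i]) (p0 : int -> R[i]) :
  (forall k (eps : R), 0 < eps -> \forall s \near F, nc (p s k - p0 k) <= eps) ->
  (\sum_(k <- freqs N) nc (p s k) ^+ 2) @[s --> F] -->
  (\sum_(k <- freqs N) nc (p0 k) ^+ 2 : R).
Proof.
move=> pF; elim: (freqs N) => [|k t IH].
  by rewrite big_nil; under eq_fun do rewrite big_nil; exact: cvg_cst.
rewrite big_cons; under eq_fun do rewrite big_cons.
apply: cvgD IH; have pk : nc (p s k) @[s --> F] --> nc (p0 k).
  apply/cvgrPdist_le => eps /(pF k); apply: filterS => s; apply: le_trans.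
  by rewrite distrC; exact: nc_dist.
by rewrite expr2; under eq_fun do rewrite expr2; exact: cvgM.
Qed.

End WindowLimits.

Lemma sum_low_pass_le {R : realType} N M (c : int -> R[i]) (G : R[i] -> R) :
  (forall k, N%:Z < `|k| -> c k = 0) -> (forall z, 0 <= G z) -> G 0 = 0 ->
  \sum_(k <- freqs M) G (c k) <= \sum_(k <- freqs N) G (c k).
Proof.
move=> c0 G_ge0 G0; apply: (@le_trans _ _ (\sum_(k <- freqs (N + M)) G (c k))).
  by apply: sum_freqs_le => //; exact: leq_addl.
by rewrite (sum_freqs_widen (N := N)) ?leq_addr// => k /c0 ->.
Qed.

Section ErrorEstimate.
Context {R : realType}.
Variables (T mu : R) (u0 : R -> R) (u : R -> R -> R).
Hypotheses (T_gt0 : 0 < T) (mu2 : 2 <= mu) (solu : kdv_solution T mu u0 u).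
Variables (N : nat) (uN : R -> R -> R).
Hypotheses (N_gt0 : (0 < N)%N) (gal : galerkin T u0 N uN).
Variable B : R.
Let a t := fourier (toC (u t)).
Let b t := fourier (toC (uN t)).
Hypothesis aB : forall t, t \in `[0, T] -> sobolev_bound mu (a t) B.
Let A := (5 + B) / 2.
Let eta := B / (N%:R `^ (mu - 1)) ^+ 2.
Let E t := \sum_(k <- freqs N) nc (b t k - a t k) ^+ 2.

Let T0 : 0 \in `[0, T]. Proof. by rewrite in_itv/= lexx ltW. Qed.
Let B0 : 0 <= B. Proof. exact: sobolev_bound_ge0 (aB T0). Qed.
Let eta0 : 0 <= eta. Proof. by rewrite divr_ge0// sqr_ge0. Qed.

Lemma coef_error_derivative t : t \in `[0, T] -> exists2 d : int -> R[i],
  (forall k, coef_derivative T (fun s => b s k - a s k) t (d k)) &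
  \sum_(k <- freqs N) (2 * complex.Re (conjc (b t k - a t k) * d k)) <=
  3 * A * (E t + eta).
Proof.
move=> tT; have [n bD nE] := galerkin_ode gal tT.
have [d [F [tail [aD tail0 Ft dE]]]] := kdv_ode solu mu2 tT.
exists (fun k => n k - d k); first by move=> k; exact: (coef_derivativeB (bD k) (aD k)).
apply: (@energy_rate _ N (a t) (b t) F _ A eta tail) => //.
- exact: (kdv_coef_conj solu tT).
- exact: (galerkin_coef_conj gal tT).
- exact: (galerkin_coef0 gal tT).
- by move=> M; exact: (sobolev_bound_l1 mu2 M (aB tT)).1.
- by move=> M; exact: (sobolev_bound_l1 mu2 M (aB tT)).2.
- by move=> M; exact: high_pass_l2 (aB tT).
- by move=> M; exact: high_pass_Dx_l2 (aB tT).
- by move=> k kN; rewrite nE// dE; ring.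
Qed.

Lemma coef_error_le t : t \in `[0, T] -> E t + eta <= eta * expR (3 * A * T).
Proof.
have A0 : 0 <= 3 * A by rewrite mulr_ge0// divr_ge0// addr_ge0.
have DE s : s \in `]0, T[ -> exists2 v, is_derive s 1 E v & v <= 3 * A * (E s + eta).
  move=> sT; have [d eD dle] := coef_error_derivative (subset_itv_oo_cc sT).
  exists (\sum_(k <- freqs N) (2 * complex.Re (conjc (b s k - a s k) * d k))) => //.
  rewrite /E; elim: (freqs N) => [|k t' IH].
    by rewrite big_nil; under eq_fun do rewrite big_nil; exact: is_derive_cst.
  rewrite big_cons; under eq_fun do rewrite big_cons.
  exact: (is_deriveD (coef_derivative_is_derive sT (eD k)) IH).
apply: (@gronwall _ _ _ _ E (fun s => 'D_1 E s)) => //.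
- rewrite /E big1_seq// => k /andP[_]; rewrite mem_freqs => kN.
  rewrite /b (galerkin_coef_initial gal)// (kdv_coef_initial solu) ?ltW//.
  by rewrite subrr ComplexField.Normc.normc0 expr0n.
- apply/subspace_continuousP => s sT; have [d eD _] := coef_error_derivative sT.
  by apply: cvg_sum_nc_sqr => k eps; exact: (coef_derivative_cvg (eD k)).
- by move=> s /DE[v Dv _]; have := @derive_val _ _ _ _ _ _ _ Dv => ->.
- by move=> s /DE[v Dv vle]; have := @derive_val _ _ _ _ _ _ _ Dv => ->.
Qed.

Lemma error_L2 t : t \in `[0, T] -> L2 (fun x => uN t x - u t x).
Proof. by move=> tT; apply: L2B; [exact: (galerkin_L2 gal tT)|exact: (kdv_L2 solu tT)]. Qed.

(** By [parseval_le] the squared norm is controlled by [E t] for the frequencies up to [N]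
    and by the tail [eta] of [u] beyond, whose sum [coef_error_le] bounds. *)
Lemma error_le t : t \in `[0, T] -> (L2norm (fun x => uN t x - u t x)%R <=
  (Num.sqrt (pi *+ 2 * B * expR (3 * A * T)) / N%:R `^ (mu - 1))%:E)%E.
Proof.
move=> tT; set q := N%:R `^ (mu - 1).
have q0 : 0 < q by rewrite powR_gt0 ?ltr0n.
have fE k : fourier (toC (fun x => uN t x - u t x)) k = b t k - a t k.
  by rewrite fourier_toCB//; apply: L2_integrable;
    [exact: (galerkin_L2 gal tT)|exact: (kdv_L2 solu tT)].
have -> : Num.sqrt (pi *+ 2 * B * expR (3 * A * T)) / q =
    Num.sqrt (pi *+ 2 * (eta * expR (3 * A * T))).
  rewrite -[X in _ / X]gtr0_norm// -sqrtr_sqr -sqrtrV ?sqr_ge0// -sqrtrM.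
    by congr Num.sqrt; rewrite /eta -/q; ring.
  by rewrite !mulr_ge0 ?expR_ge0// ltW// pi2_gt0.
apply: (L2norm_le (A := \sum_(k <- freqs N) nc (b t k) + A)) => [|M|M].
- exact: error_L2.
- under eq_bigr do rewrite fE.
  apply: (@le_trans _ _ (\sum_(k <- freqs M) nc (b t k) + \sum_(k <- freqs M) nc (a t k))).
    rewrite -big_split; apply: ler_sum => k _.
    by apply: le_trans (le_normcD _ _) _; rewrite normcN.
  apply: lerD; last exact: (sobolev_bound_l1 mu2 M (aB tT)).1.
  apply: sum_low_pass_le (galerkin_coef0 gal tT) _ _; first exact: nc_ge0.
  exact: ComplexField.Normc.normc0.
- apply: le_trans (coef_error_le tT); under eq_bigr do rewrite fE.
  pose e := low_pass N (fun k => b t k - a t k).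
  apply: (@le_trans _ _ (\sum_(k <- freqs M) nc (e k) ^+ 2 +
     \sum_(k <- freqs M) nc (high_pass N (a t) k) ^+ 2)).
    rewrite -big_split; apply: ler_sum => k _.
    rewrite /e /low_pass /high_pass; case: ifPn => [_|kN].
      by rewrite lerDl sqr_ge0.
    rewrite /b (galerkin_coef0 gal tT) ?ltNge// sub0r normcN.
    by rewrite lerDr sqr_ge0.
  apply: lerD; last exact: high_pass_l2 (aB tT).
  apply: (@le_trans _ _ (\sum_(k <- freqs N) nc (e k) ^+ 2)).
    apply: (sum_low_pass_le _ (G := fun z => nc z ^+ 2)).
    - by move=> k; rewrite ltNge /e /low_pass => /negbTE ->.
    - by move=> z; exact: sqr_ge0.
    - by rewrite ComplexField.Normc.normc0 expr0n.
  rewrite big_seq [leRHS]big_seq; apply: ler_sum => k.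
  by rewrite mem_freqs /e /low_pass => ->.
Qed.

Lemma kdv_L2_continuous t : t \in `[0, T] -> forall eps : R, 0 < eps ->
  \forall s \near within `[0, T] (nbhs t),
    (L2norm (fun x => u s x - u t x)%R <= eps%:E)%E.
Proof.
move=> tT eps e0; have p0 : 0 < Num.sqrt (pi *+ 2) :> R by rewrite sqrtr_gt0 pi2_gt0.
have d0 : 0 < eps / Num.sqrt (pi *+ 2) by rewrite divr_gt0.
have /cvge0_le/(_ _ d0) := kdv_continuous solu tT.
rewrite !near_withinE; apply: filterS => s sd sT; have {sd} := sd sT.
set delta := eps / _ => sd.
have dB := sobolev_norm_bound (ltW d0) sd.
have Ls := kdv_L2 solu sT; have Lt := kdv_L2 solu tT.
have fE k : fourier (toC (fun x => u s x - u t x)) k = a s k - a t k.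
  by rewrite fourier_toCB//; exact: L2_integrable.
have -> : eps = Num.sqrt (pi *+ 2 * delta ^+ 2).
  rewrite sqrtrM ?ltW ?pi2_gt0// sqrtr_sqr gtr0_norm// /delta mulrC divfK//.
  by rewrite gt_eqF.
apply: (L2norm_le (A := (5 + delta ^+ 2) / 2)) => [|M|M]; first exact: L2B.
- under eq_bigr do rewrite fE; exact: (sobolev_bound_l1 mu2 M dB).1.
- under eq_bigr do rewrite fE; exact: (sobolev_bound_l2 mu2 M dB).
Qed.

Lemma galerkin_L2_continuous t : t \in `[0, T] -> forall eps : R, 0 < eps ->
  \forall s \near within `[0, T] (nbhs t),
    (L2norm (fun x => uN s x - uN t x)%R <= eps%:E)%E.
Proof.
move=> tT eps e0; have p0 := @pi2_gt0 R.
have d0 : 0 < eps ^+ 2 / (pi *+ 2) by rewrite divr_gt0 ?exprn_gt0.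
have [n bD _] := galerkin_ode gal tT.
have cv : (\sum_(k <- freqs N) nc (b s k - b t k) ^+ 2)
    @[s --> within `[0, T] (nbhs t)] --> (\sum_(k <- freqs N) nc (0 : R[i]) ^+ 2 : R).
  apply: (cvg_sum_nc_sqr (p := fun s k => b s k - b t k)) => k e /(coef_derivative_cvg (bD k)).
  by apply: filterS => s; rewrite subr0.
move: cv; rewrite big1; last by move=> k _; rewrite ComplexField.Normc.normc0 expr0n.
move=> /cvgr0_norm_le/(_ _ d0); rewrite !near_withinE; apply: filterS => s sd sT.
have {sd} := le_trans (ler_norm _) (sd sT); set S := \sum_(k <- _) _ => Sd.
have Ls := galerkin_L2 gal sT; have Lt := galerkin_L2 gal tT.
have fE k : fourier (toC (fun x => uN s x - uN t x)) k = b s k - b t k.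
  by rewrite fourier_toCB//; exact: L2_integrable.
have bst k : N%:Z < `|k| -> b s k - b t k = 0.
  by move=> kN; rewrite /b (galerkin_coef0 gal sT)// (galerkin_coef0 gal tT)// subrr.
apply: (@le_trans _ _ (Num.sqrt (pi *+ 2 * S))%:E); last first.
  rewrite lee_fin -[leRHS]gtr0_norm// -sqrtr_sqr ler_wsqrtr// mulrC.
  by rewrite -ler_pdivlMr.
apply: (L2norm_le (A := \sum_(k <- freqs N) nc (b s k - b t k))) => [|M|M].
- exact: L2B.
- under eq_bigr do rewrite fE.
  apply: sum_low_pass_le bst _ _; first exact: nc_ge0.
  exact: ComplexField.Normc.normc0.
- under eq_bigr do rewrite fE.
  have G0 (z : R[i]) : 0 <= nc z ^+ 2 by exact: sqr_ge0.
  apply: (sum_low_pass_le M (c := fun k => b s k - b t k) bst G0).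
  by rewrite ComplexField.Normc.normc0 expr0n.
Qed.

(** Minkowski's inequality turns the continuity of [u] and [uN] with values in [L^2] into
    that of the error norm, to which the extreme value theorem applies. *)
Lemma error_max : exists M,
  is_max T (fun t => L2norm (fun x => uN t x - u t x)) M.
Proof.
pose f t x := uN t x - u t x; pose phi t := fine (L2norm (f t)).
have phiE t : t \in `[0, T] -> L2norm (f t) = (phi t)%:E.
  by move=> tT; have [r _ fr] := L2norm_fin (error_L2 tT); rewrite /phi /f fr.
have cphi : {within `[0, T], continuous phi}.
  apply/subspace_continuousP => t tT; apply/cvgrPdist_le => eps e0.
  have e2 : 0 < eps / 2 by rewrite divr_gt0.
  have := galerkin_L2_continuous tT e2; have := kdv_L2_continuous tT e2.
  rewrite !near_withinE; apply: filterS2 => s us uNs sT.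
  have step s' t' : s' \in `[0, T] -> t' \in `[0, T] ->
      (L2norm (fun x => u s' x - u t' x)%R <= (eps / 2)%:E)%E ->
      (L2norm (fun x => uN s' x - uN t' x)%R <= (eps / 2)%:E)%E ->
      phi s' - phi t' <= eps.
    move=> s'T t'T us' uNs'; rewrite lerBlDr -lee_fin EFinD -!phiE//.
    have Lu := L2B (kdv_L2 solu t'T) (kdv_L2 solu s'T).
    have LuN := L2B (galerkin_L2 gal s'T) (galerkin_L2 gal t'T).
    have := L2normD (L2D LuN Lu) (error_L2 t'T).
    rewrite (_ : (fun x => _) = f s'); last by apply/funext => x; rewrite /f; ring.
    move=> /le_trans; apply; apply: leeD; last exact: lexx.
    apply: le_trans (L2normD LuN Lu) _; rewrite (splitr eps) EFinD.
    by apply: leeD => //; rewrite L2norm_subC.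
  rewrite ler_norml lerNl opprB; apply/andP; split.
    by apply: step => //; [exact: us|exact: uNs].
  by apply: step => //; rewrite L2norm_subC; [exact: us|exact: uNs].
have [c cT cmax] := EVT_max (ltW T_gt0) cphi.
exists (L2norm (f c)); split; first by exists c.
by move=> t tT; rewrite -/(f t) !phiE// lee_fin cmax.
Qed.

End ErrorEstimate.

Unset Implicit Arguments.

Theorem theorem3p1 (R : realType) (T mu : R) (u0 : R -> R) (u : R -> R -> R)
    (uN : nat -> R -> R -> R)
    (T_gt0 : 0 < T) (mu_ge2 : 2 <= mu)
    (solu : kdv_solution T mu u0 u)
    (soluN : forall N : nat, (1 <= N)%N -> galerkin T u0 N (uN N)) :
  exists C : R, forall N : nat, (1 <= N)%N ->
    exists2 M : \bar R,
      is_max T (fun t => L2norm (fun x => uN N t x - u t x)) M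
      & (M <= (C / N%:R `^ (mu - 1))%:E)%E.
Proof.
have [B aB] := kdv_bounded solu.
exists (Num.sqrt (pi *+ 2 * B * expR (3 * ((5 + B) / 2) * T))) => N N1.
have [M Mmax] := error_max T_gt0 mu_ge2 solu (soluN N N1).
exists M => //; have [[t tT <-] _] := Mmax.
exact: (error_le T_gt0 mu_ge2 solu N1 (soluN N N1) aB tT).
Qed.
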